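(* Let $(X,\mu)$ be a non-atomic measure space with a dyadic grid $\mathcal{D}$. Let $m\geq 2$ and, for $i=1,\dots,m-1$, let $0<r_i<\infty$, $0\leq\rho_i<1$ and $1<t_i<1/\rho_i$ (with $1/0=\infty$). Put $$\alpha:=\sum_{i=1}^{m-1} r_i(1/t_i-\rho_i),\qquad q_i:=r_i/t_i'\ \text{ for } i<m,\qquad q_m:=\alpha,\qquad \vec q=(q_1,\dots,q_m).$$ Then for every tuple of weights $\vec w=(w_1,\dots,w_m)$ and all non-negative measurable functions $f_1,\dots,f_{m-1}$ on $X$ the following two estimates hold: $$\big\| \mathcal{M}^{\vec r}_{\vec\rho}(f_1w_1,\dots,f_{m-1}w_{m-1}) \big\|_{L^{1/\alpha,\infty}(w_m)} \lesssim [\vec w]^{\vec q}\prod_{i=1}^{m-1}\|f_i\|_{L^{t_i}(w_i)}^{r_i}$$ and $$\big\| \mathcal{M}^{\vec r}_{\vec\rho}(f_1w_1,\dots,f_{m-1}w_{m-1}) \big\|_{L^{1/\alpha}(w_m)} \lesssim [\vec w]^{\vec q}\,[\vec w]_{FW}^{(r_i(1/t_i-\rho_i))_{i\neq m}}\prod_{i=1}^{m-1}\|f_i\|_{L^{t_i}(w_i)}^{r_i}.$$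
   Context: Write $|E|=\mu(E)$ for measurable $E\subset X$. A dyadic grid is a (countable) collection $\mathcal{D}$ of measurable subsets of $X$ (''cubes'') with $0<|Q|<\infty$ such that for all $Q,Q'\in\mathcal{D}$ either $Q\subseteq Q'$, $Q'\subseteq Q$ or $Q\cap Q'=\emptyset$. No doubling assumption is made. All functions are non-negative. A weight is a non-negative measurable function on $X$; $L^p(w)$ and $L^{p,\infty}(w)$ are the (weak) Lebesgue spaces with respect to the measure $w\,d\mu$. $t'=t/(t-1)$ is the conjugate exponent, and $(w)_Q=|Q|^{-1}\int_Q w\,d\mu$. Maximal function: for exponents $\vec r=(r_1,\dots,r_k)$, $\vec\rho=(\rho_1,\dots,\rho_k)$ and functions $f_1,\dots,f_k$, $$\mathcal{M}^{\vec r}_{\vec\rho}(f_1,\dots,f_k)(x)=\sup_{Q\in\mathcal{D},\,x\in Q}\ \prod_{i=1}^{k}\Big(|Q|^{-(1-\rho_i)}\int_Q f_i\,d\mu\Big)^{r_i},$$ and $\mathcal{M}^{\vec r}=\mathcal{M}^{\vec r}_{\vec 0}$. A factor with exponent $0$ is omitted. Multilinear Muckenhoupt characteristic: for $\vec q=(q_1,\dots,q_m)$ with $0\le q_i<\infty$, $[\vec w]^{\vec q}=\sup_{Q\in\mathcal{D}}\prod_{i=1}^m (w_i)_Q^{q_i}$. Multilinear Fujii--Wilson characteristic: for $\vec\beta=(\beta_1,\dots,\beta_m)$ with $0\le\beta_i<\infty$ and $\beta=\sum_i\beta_i$, $$[\vec w]_{FW}^{\vec\beta}=\sup_{Q\in\mathcal{D}}\Big(\int_Q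 \mathcal{M}^{\vec\beta/\beta}(1_Qw_1,\dots,1_Qw_m)\,d\mu\Big)^{\beta}\Big(\int_Q\prod_{i=1}^m w_i^{\beta_i/\beta}\,d\mu\Big)^{-\beta}.$$ $(\beta_i)_{i\neq j}$ denotes the vector of length $m$ whose $i$-th entry is $\beta_i$ for $i\neq j$ and $0$ for $i=j$. $A\lesssim B$ means $A\le CB$ with $C$ depending only on $m,\vec r,\vec\rho,\vec t$ (not on $X,\mu,\mathcal{D}$, the weights or the functions). *)

(* Defs.v *)
From mathcomp Require Import all_boot all_order all_algebra.
From mathcomp Require Import all_classical all_reals all_analysis.
From mathcomp Require Import measurable_realfun.

Set Implicit Arguments.
Unset Strict Implicit.
Unset Printing Implicit Defensive.

Import Order.TTheory GRing.Theory Num.Theory.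

Local Open Scope classical_set_scope.
Local Open Scope ring_scope.
Local Open Scope ereal_scope.

(* Functions and weights take values in [0, +oo], and 0 * +oo = 0 as in
   measure theory. *)

Section dyadic.
Context {d : measure_display} {T : measurableType d} {R : realType}.
Implicit Types (mu : {measure set T -> \bar R}) (D : set (set T)).

Definition non_atomic mu : Prop :=
  forall A, measurable A -> 0 < mu A ->
    exists B, [/\ measurable B, B `<=` A, 0 < mu B & mu B < mu A].

Definition dyadic_grid mu D : Prop :=
  [/\ countable D,
      forall Q, D Q -> [/\ measurable Q, 0 < mu Q & mu Q < +oo] &
      forall Q Q', D Q -> D Q' ->
        [\/ Q `<=` Q', Q' `<=` Q | Q `&` Q' = set0]].

Definition nonneg_measurable (f : T -> \bar R) : Prop :=
  measurable_fun [set: T] f /\ forall x, 0 <= f x.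

(* Suprema are taken in [0, +oo], so that the empty one is 0 and not -oo. *)
Definition sup_ge0 (S : set (\bar R)) : \bar R := ereal_sup (0 |` S).

(* [x `^ 0 = 1] for every [x], including +oo: factors with exponent 0 are
   omitted. *)
Definition maximal mu D (k : nat) (r rho : 'I_k -> R) (f : 'I_k -> T -> \bar R)
    (x : T) : \bar R :=
  sup_ge0 [set \prod_(i < k)
      (mu Q `^ (- (1 - rho i))%R * \int[mu]_(y in Q) f i y) `^ r i
    | Q in [set Q | D Q /\ Q x]].

Definition average mu (Q : set T) (w : T -> \bar R) : \bar R :=
  (mu Q)^-1 * \int[mu]_(x in Q) w x.

Definition muckenhoupt mu D (m : nat) (q : 'I_m -> R)
    (w : 'I_m -> T -> \bar R) : \bar R :=
  sup_ge0 [set \prod_(i < m) average mu Q (w i) `^ q i | Q in D].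

(* The quotient in [0, +oo], with a / 0 = +oo for a > 0.  The indeterminate
   forms 0 / 0 and +oo / +oo are read as 1, the lower bound that Hoelder's
   inequality gives for every other term of [fujii_wilson]; [a / b], being
   a * b^-1, would be 0 in both cases. *)
Definition quotient (a b : \bar R) : \bar R := if a == b then 1 else a / b.

(* Raising to the power - b is written as a division, because the library has
   [0 `^ (- b) = 0]. *)
Definition fujii_wilson mu D (m : nat) (beta : 'I_m -> R)
    (w : 'I_m -> T -> \bar R) : \bar R :=
  let b := (\sum_(i < m) beta i)%R in
  sup_ge0 [set quotient
      ((\int[mu]_(x in Q)
          maximal mu D (fun i => beta i / b)%R (fun=> 0%R)
            (fun i y => (\1_Q y)%:E * w i y) x) `^ b)
      ((\int[mu]_(x in Q) \prod_(i < m) w i x `^ (beta i / b)) `^ b)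
    | Q in D].

(* The norms of L^p(w) and L^{p,oo}(w) for a non-negative function, with
   respect to the measure w dmu. *)
Definition weighted_norm mu (p : R) (w f : T -> \bar R) : \bar R :=
  (\int[mu]_x (f x `^ p * w x)) `^ p^-1.

Definition weak_weighted_norm mu (p : R) (w f : T -> \bar R) : \bar R :=
  sup_ge0 [set l%:E * (\int[mu]_(x in [set x | l%:E < f x]) w x) `^ p^-1
    | l in [set l : R | (0 < l)%R]].

End dyadic.

Definition conj_exponent {R : realType} (t : R) : R := (t / (t - 1))%R.

(* The vector (x_1, ..., x_n, a).  An m-tuple is split as m = n.+1, with
   [lift ord_max i] the index i < m and [ord_max] the index m. *)
Definition append_last {R : realType} (n : nat) (x : 'I_n -> R) (a : R)
    (i : 'I_n.+1) : R :=
  if unlift ord_max i is Some j then x j else a.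

(* Main.v *)
(* On one cube Q, Hoelder's inequality in each variable bounds the value of the
   maximal operator on Q by the Muckenhoupt average of Q and the masses of
   [f_i ^ t_i v_i] on Q.  For finitely many cubes the weak-type estimate follows
   by summing over the maximal cubes of a level set: the exponents [r_i / t_i]
   add up to at least [alpha], so the sum of products is at most the product of
   the sums.

   For the strong-type estimate, pass to principal cubes, along which the value
   of the operator grows geometrically and which are therefore sparse for [mu].
   After factoring out the Muckenhoupt characteristic, a principal cube Q
   contributes [mu Q * h Q * H Q], where [h Q] is a geometric mean of the averages
   of the weights and [H Q] involves only the averages of the [f_i] with respect to
   [v_i dmu].  The Carleson embedding theorem is applied twice: once to
   [mu Q * h Q], where sparseness and the Fujii-Wilson characteristic give a Carleson
   sequence with respect to the geometric mean of the weights, and once to [H].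
   Hoelder's inequality and Doob's maximal inequality in each [L ^ t_i (v_i)] then
   finish the proof; the fractional exponents [rho_i] are absorbed by the
   pointwise bound [(average of f_i) ^ t_i * v_i(Q) <= int f_i ^ t_i v_i].

   Infinite values are confined to cubes on which the operator or the weight
   [w_m] vanishes, and countable families are exhausted by finite ones. *)

Require Import Defs.
From mathcomp Require Import all_boot all_order all_algebra.
From mathcomp Require Import all_classical all_reals all_analysis.
From mathcomp Require Import measurable_realfun.
From mathcomp Require Import ring lra.

Set Implicit Arguments.
Unset Strict Implicit.
Unset Printing Implicit Defensive.

Import Order.TTheory GRing.Theory Num.Theory.

Local Open Scope classical_set_scope.
Local Open Scope ring_scope.
Local Open Scope ereal_scope.

(** * Weighted arithmetic-geometric mean and Hoelder inequalities for finite sums *)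

Section real_inequalities.
Context {R : realType}.
Local Open Scope ring_scope.

Lemma prod_powR_expR (I : finType) (c u : I -> R) : (forall i, 0 < u i) ->
  \prod_i u i `^ c i = expR (\sum_i c i * ln (u i)).
Proof.
by move=> u0; rewrite expR_sum; apply: eq_bigr => i _; rewrite /powR gt_eqF.
Qed.

(** Summing [ln x <= x - 1] at [x = u i / U] with weights [c i], where [U] is the weighted mean,
    makes the right-hand sides cancel. The logarithm needs positive entries, so a vanishing one is
    treated first. *)
Lemma prod_powR_le_sum (I : finType) (c u : I -> R) :
  (forall i, 0 < c i) -> \sum_i c i = 1 -> (forall i, 0 <= u i) ->
  \prod_i u i `^ c i <= \sum_i c i * u i.
Proof.
move=> c0 c1 u0.
have U0 : 0 <= \sum_i c i * u i by apply: sumr_ge0 => i _; rewrite mulr_ge0// ltW.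
have [/existsP[j /eqP uj]|/existsPn u_neq0] := boolP [exists i, u i == 0].
  by rewrite (bigD1 j)//= uj powR0 ?gt_eqF// mul0r.
have {u_neq0}ugt0 i : 0 < u i by rewrite lt0r u_neq0 u0.
have Ugt0 : 0 < \sum_i c i * u i.
  rewrite lt0r U0 andbT; apply/negP => /eqP /psumr_eq0P U_eq0.
  have [i _|Ic] := pickP (fun _ : I => true).
    have /eqP := U_eq0 (fun i _ => mulr_ge0 (ltW (c0 i)) (u0 i)) i isT.
    by rewrite mulf_eq0 !gt_eqF.
  by move: c1; rewrite big_pred0// => /esym/eqP; rewrite oner_eq0.
rewrite prod_powR_expR//; set U := (X in _ <= X) in U0 Ugt0 *.
rewrite -[leRHS]lnK ?posrE// ler_expR -subr_ge0 -[ln U]mul1r -c1 mulr_suml.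
rewrite -sumrB.
rewrite [leLHS](_ : 0 = \sum_i c i * (1 - u i / U)); last first.
  under eq_bigr do rewrite mulrBr mulr1 mulrA.
  by rewrite sumrB -mulr_suml c1 divff ?gt_eqF// subrr.
apply: ler_sum => i _; rewrite -mulrBr; apply: ler_wpM2l; first exact: ltW.
have := @le_ln1Dx R (u i / U - 1).
rewrite ltrBrDl subrr divr_gt0// => /(_ isT).
rewrite subrKC ln_div ?posrE//; lra.
Qed.

(** After division by the totals [t i] every entry lies in [0, 1], so lowering the exponents [c i]
    to [c i / C], which add up to 1, only increases the product. The arithmetic-geometric mean then
    leaves a sum over [k] equal to 1. *)
Lemma sum_prod_powR_le (I : finType) (T : eqType) (s : seq T) (c : I -> R)
    (A : I -> T -> R) :
  (forall i, 0 < c i) -> 1 <= \sum_i c i -> (forall i k, 0 <= A i k) ->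
  \sum_(k <- s) \prod_i A i k `^ c i <= \prod_i (\sum_(k <- s) A i k) `^ c i.
Proof.
move=> c0 c1 A0; set C := \sum_i c i in c1.
have C0 : 0 < C by apply: lt_le_trans c1.
pose t i := \sum_(k <- s) A i k.
have t0 i : 0 <= t i by apply: sumr_ge0.
have prod0 (k : T) j : A j k = 0 -> \prod_i A i k `^ c i = 0.
  by move=> Aj; rewrite (bigD1 j)//= Aj powR0 ?gt_eqF// mul0r.
have [/existsP[j /eqP tj]|/existsPn t_neq0] := boolP [exists i, t i == 0].
  suff : forall r : seq T, \sum_(k <- r) A j k = 0 ->
      \sum_(k <- r) \prod_i A i k `^ c i = 0.
    by move=> /(_ _ tj) ->; apply: prodr_ge0 => i _; exact: powR_ge0.
  elim=> [|k r IHr]; first by rewrite !big_nil.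
  rewrite !big_cons => /eqP; rewrite paddr_eq0 ?sumr_ge0//.
  by move=> /andP[/eqP/prod0 -> /eqP/IHr ->]; rewrite addr0.
have {t_neq0}tgt0 i : 0 < t i by rewrite lt0r t_neq0 t0.
have sum_u i : \sum_(k <- s) A i k / t i = 1.
  by rewrite -mulr_suml divff// gt_eqF//; exact: tgt0.
have key k : (forall i, A i k <= t i) ->
    \prod_i A i k `^ c i <= (\prod_i t i `^ c i) * \sum_i c i / C * (A i k / t i).
  move=> At; rewrite (eq_bigr (fun i => t i `^ c i * (A i k / t i) `^ c i)).
    rewrite big_split/= ler_wpM2l//; first by apply: prodr_ge0 => i _; exact: powR_ge0.
    apply: le_trans (prod_powR_le_sum _ _ _); last 3 first.
    - by move=> i; rewrite divr_gt0.
    - by rewrite -mulr_suml divff// gt_eqF.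
    - by move=> i; rewrite divr_ge0.
    apply: ler_prod => i _; rewrite powR_ge0/=.
    have [/eqP ->|Aneq0] := boolP (A i k / t i == 0).
      by rewrite powR0 ?gt_eqF// powR_ge0.
    apply: ger_powR; last by rewrite ler_pdivrMr// ler_peMr// ltW.
    by rewrite lt0r Aneq0 divr_ge0//= ler_pdivrMr// mul1r.
  by move=> i _; rewrite -powRM ?divr_ge0// mulrCA divff ?mulr1 ?gt_eqF.
rewrite big_seq.
apply: le_trans (_ : \sum_(k <- s | k \in s)
    (\prod_i t i `^ c i) * \sum_i c i / C * (A i k / t i) <= _).
  apply: ler_sum => k ks; apply: key => i.
  by rewrite /t (big_rem k)//= lerDl sumr_ge0.
rewrite -big_seq -big_distrr/= exchange_big/=.
rewrite [X in _ * X <= _](_ : _ = 1) ?mulr1//.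
under eq_bigr do rewrite -mulr_sumr sum_u mulr1.
by rewrite -mulr_suml divff ?gt_eqF.
Qed.

Lemma powR_prod (I : finType) (u : I -> R) (p : R) : (forall i, 0 <= u i) ->
  (\prod_i u i) `^ p = \prod_i u i `^ p.
Proof.
move=> u0; apply: EFin_inj; rewrite -poweR_EFin -!prodEFin.
elim: (index_enum I) => [|i s IHs]; first by rewrite !big_nil poweR1r.
rewrite !big_cons poweRM ?IHs// ?lee_fin//.
by apply: prode_ge0 => j _; rewrite lee_fin.
Qed.

End real_inequalities.

(** * Laminar families: maximal cubes, integrals over disjoint cubes, Carleson sums *)

Section laminar_families.
Context {d : measure_display} {T : measurableType d} {R : realType}.
Variable mu : {measure set T -> \bar R}.
Implicit Types (S : seq (set T)) (Q A : set T).

Definition laminar S := forall Q Q', Q \in S -> Q' \in S ->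
  [\/ Q `<=` Q', Q' `<=` Q | Q `&` Q' = set0].

(** Positions of the list are compared, so a nonempty cube occurs at most once and sums over the
    list do not count it twice. *)
Definition disjoint_family S :=
  pairwise (fun Q Q' => `[< Q `&` Q' = set0 >]) S.

Lemma laminar_sub S S' : {subset S' <= S} -> laminar S -> laminar S'.
Proof. by move=> sub lam Q Q' QS QS'; apply: lam; exact: sub. Qed.

(** The maximal members, found by inserting one cube at a time: a cube inside one already kept is
    skipped, otherwise it replaces those it contains. *)
Lemma laminar_cover S : laminar S -> exists S0,
  [/\ {subset S0 <= S}, disjoint_family S0 &
      forall Q, Q \in S -> exists2 Q', Q' \in S0 & Q `<=` Q'].
Proof.
elim: S => [_|Q S IHS lam]; first by exists [::].
have [|S0 [S0S dS0 covS0]] := IHS.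
  by apply: laminar_sub lam => Q' Q'S; rewrite inE Q'S orbT.
have [[P PS0 QP]|noP] := pselect (exists2 P, P \in S0 & Q `<=` P).
  exists S0; split => //; first by move=> Q' /S0S; rewrite inE => ->; rewrite orbT.
  move=> Q'; rewrite inE => /predU1P[->|/covS0//]; by exists P.
exists (Q :: [seq P <- S0 | ~~ `[< P `<=` Q >]]); split.
- move=> P; rewrite !inE mem_filter => /predU1P[->|/andP[_ /S0S ->]].
    by rewrite eqxx.
  by rewrite orbT.
- rewrite /disjoint_family/= pairwise_filter// andbT.
  apply/allP => P; rewrite mem_filter => /andP[/asboolPn nPQ PS0].
  apply/asboolP; have := lam Q P (mem_head _ _).
  rewrite inE (S0S _ PS0) orbT => /(_ isT)[QP|//|//].
  by exfalso; apply: noP; exists P.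
- move=> Q'; rewrite inE => /predU1P[->|Q'S]; first by exists Q; rewrite ?mem_head.
  have [P PS0 Q'P] := covS0 _ Q'S.
  have [PQ|nPQ] := pselect (P `<=` Q).
    by exists Q; rewrite ?mem_head//; apply: subset_trans PQ.
  exists P => //; rewrite inE mem_filter PS0 andbT orbC.
  by apply/orP; left; apply/asboolPn.
Qed.

Lemma sum_le_cover S S0 (a : set T -> R) : (forall Q, (0 <= a Q)%R) ->
  (forall Q, Q \in S -> exists2 P, P \in S0 & Q `<=` P) ->
  (\sum_(Q <- S) a Q <= \sum_(P <- S0) \sum_(Q <- S | `[< Q `<=` P >]) a Q)%R.
Proof.
move=> a0 covS0; under [leRHS]eq_bigr do rewrite big_mkcond.
rewrite [leRHS]exchange_big/= big_seq [leRHS]big_seq; apply: ler_sum => Q QS.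
have [P PS0 QP] := covS0 _ QS.
rewrite (big_rem P)//=; case: asboolP => // _.
by rewrite lerDl sumr_ge0// => P' _; case: ifPn.
Qed.

Section integrals.
Variable g : T -> \bar R.
Hypotheses (mg : measurable_fun [set: T] g) (g0 : forall x, 0 <= g x).

Lemma sum_integral_disjoint_le S A : measurable A ->
  (forall Q, Q \in S -> measurable Q /\ Q `<=` A) -> disjoint_family S ->
  \sum_(Q <- S) \int[mu]_(x in Q) g x <= \int[mu]_(x in A) g x.
Proof.
elim: S A => [A mA _ _|Q S IHS A mA SA]; first by rewrite big_nil integral_ge0.
rewrite /disjoint_family/= => /andP[/allP dQ dS]; rewrite big_cons.
have [mQ QA] := SA Q (mem_head _ _).
have mAQ : measurable (A `\` Q) by exact: measurableD.
rewrite -[in leRHS](setDUK QA) ge0_integral_setU//; last 2 first.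
- exact: measurable_funTS.
- by rewrite disj_set2E; apply/eqP/seteqP; split=> // x [Qx [_ /(_ Qx)]].
apply: leeD => //; apply: IHS => // Q' Q'S.
have [mQ' Q'A] := SA Q' (mem_behead (s := _ :: _) Q'S); split => // x Q'x.
split; first exact: Q'A.
move=> Qx; have /= /asboolP QQ' := dQ _ Q'S.
by have : (Q `&` Q') x by []; rewrite QQ'.
Qed.

Lemma integral_cover_le S A : measurable A ->
  (forall Q, Q \in S -> measurable Q) ->
  (forall x, A x -> exists2 Q, Q \in S & Q x) ->
  \int[mu]_(x in A) g x <= \sum_(Q <- S) \int[mu]_(x in Q) g x.
Proof.
elim: S A => [A mA _ A0|Q S IHS A mA mS AS].
  rewrite (_ : A = set0) ?integral_set0 ?big_nil//.
  by apply/seteqP; split=> // x /A0[].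
have mQ : measurable Q by apply: mS; rewrite mem_head.
have mAQ : measurable (A `\` Q) by exact: measurableD.
rewrite big_cons; apply: (@le_trans _ _
    (\int[mu]_(x in A `&` Q) g x + \int[mu]_(x in A `\` Q) g x)).
  rewrite -[in leLHS](setD0 A) -(setDv Q) setDDr setUC ge0_integral_setU//.
  - exact: measurableI.
  - exact: measurable_funTS.
  - by rewrite disj_set2E; apply/eqP/seteqP; split=> // x [[_ Qx] [_ /(_ Qx)]].
apply: leeD.
  apply: ge0_subset_integral => //; first exact: measurableI.
  exact: measurable_funTS.
apply: IHS => // [Q' Q'S|x [Ax nQx]]; first by apply: mS; rewrite inE Q'S orbT.
have [Q'] := AS _ Ax; rewrite inE => /predU1P[->//|Q'S Q'x]; by exists Q'.
Qed.

(** The sum splits over the maximal cubes; these are disjoint, so their integrals add up to at most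
    the integral over [A]. *)
Lemma carleson_sum S A (a : set T -> R) (C : R) : laminar S -> measurable A ->
  (forall Q, Q \in S -> measurable Q /\ Q `<=` A) ->
  (forall Q, (0 <= a Q)%R) -> (0 <= C)%R ->
  (forall P, P \in S -> (\sum_(Q <- S | `[< Q `<=` P >]) a Q)%R%:E <=
                        C%:E * \int[mu]_(x in P) g x) ->
  (\sum_(Q <- S) a Q)%R%:E <= C%:E * \int[mu]_(x in A) g x.
Proof.
move=> lam mA SA a0 C0 carl; have [S0 [S0S dS0 covS0]] := laminar_cover lam.
apply: (@le_trans _ _
    (\sum_(P <- S0) \sum_(Q <- S | `[< Q `<=` P >]) a Q)%R%:E).
  by rewrite lee_fin; exact: sum_le_cover.
rewrite -sumEFin.
apply: (@le_trans _ _ (\sum_(P <- S0) C%:E * \int[mu]_(x in P) g x)).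
  rewrite big_seq [leRHS]big_seq; apply: lee_sum => P /S0S; exact: carl.
rewrite -ge0_sume_distrr; last by move=> P _; exact: integral_ge0.
apply: lee_wpmul2l; first by rewrite lee_fin.
by apply: sum_integral_disjoint_le => // Q /S0S /SA.
Qed.

End integrals.
End laminar_families.

(** * Maximal functions of finite families, as step functions *)

Section step_maximum.
Context {d : measure_display} {T : measurableType d}.
Implicit Types (S : seq (set T)) (Q : set T).

(** The base value [b] is a parameter so that layers can be removed from below; [V] will be the
    reals or the extended reals. *)
Definition stepmax {disp} {V : orderType disp} (b : V) S (h : set T -> V)
    (x : T) : V :=
  \big[Order.max/b]_(Q <- S | x \in Q) h Q.

Definition union_of S : set T := [set x | exists2 Q, Q \in S & Q x].

Lemma measurable_union_of S : (forall Q, Q \in S -> measurable Q) ->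
  measurable (union_of S).
Proof.
elim: S => [_|Q S IHS mS].
  by rewrite (_ : union_of _ = set0)//; apply/seteqP; split=> // x [].
rewrite (_ : union_of _ = Q `|` union_of S).
  apply: measurableU; first by apply: mS; rewrite mem_head.
  by apply: IHS => P PS; apply: mS; rewrite inE PS orbT.
apply/seteqP; split=> x.
  by move=> [P]; rewrite inE => /predU1P[->|PS Px]; [left|right; exists P].
by move=> [Qx|[P PS Px]]; [exists Q|exists P]; rewrite // inE ?eqxx ?PS ?orbT.
Qed.

Section order.
Context {disp : Order.disp_t} {V : orderType disp}.
Implicit Types (b y : V) (h : set T -> V).

Lemma stepmax_ge_id b S h x : (b <= stepmax b S h x)%O.
Proof. exact: bigmax_ge_id. Qed.

Lemma stepmax_ge b S h x Q : Q \in S -> Q x -> (h Q <= stepmax b S h x)%O.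
Proof. by move=> QS Qx; apply: le_bigmax_seq => //; exact: mem_set. Qed.

Lemma stepmax_le b S h x y : (b <= y)%O ->
  (forall Q, Q \in S -> Q x -> (h Q <= y)%O) -> (stepmax b S h x <= y)%O.
Proof.
move=> bY hy; rewrite /stepmax big_seq_cond; apply: bigmax_le => // Q.
by move=> /andP[QS /set_mem]; exact: hy.
Qed.

Lemma eq_stepmax b S S' h : S =i S' -> stepmax b S h = stepmax b S' h.
Proof.
move=> SS'; apply/funext => x; apply/le_anti/andP; split;
  apply: stepmax_le (stepmax_ge_id _ _ _ _) _ => Q QS; apply: stepmax_ge;
  by rewrite ?SS' // -SS'.
Qed.

Lemma stepmax_out b S h x : ~ union_of S x -> stepmax b S h x = b.
Proof.
move=> Sx; apply/le_anti; rewrite stepmax_ge_id andbT.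
by apply: stepmax_le => // Q QS Qx; exfalso; apply: Sx; exists Q.
Qed.

(** On the union of the cubes the smallest value [h Q] is always reached, by [Q] or by a cube with a
    larger value, so the base can be raised to it. *)
Lemma stepmax_cons_min b Q S h x : (b <= h Q)%O ->
  (forall P, P \in S -> (h Q <= h P)%O) -> union_of (Q :: S) x ->
  stepmax b (Q :: S) h x = stepmax (h Q) S h x.
Proof.
move=> bQ QP [P PS Px]; apply/le_anti/andP; split.
  apply: stepmax_le; first exact: le_trans (stepmax_ge_id _ _ _ _).
  move=> P' + P'x; rewrite inE => /predU1P[->|P'S]; first exact: stepmax_ge_id.
  exact: stepmax_ge.
apply: stepmax_le => [|P' P'S P'x].
  apply: (@le_trans _ _ (h P)); last exact: stepmax_ge.
  by move: PS; rewrite inE => /predU1P[->|/QP].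
by apply: stepmax_ge => //; rewrite inE P'S orbT.
Qed.

(** [F] is generalized in the induction, so that [Order.max (h Q)] is absorbed into it. *)
Lemma measurable_stepmax {d' : measure_display} {V' : measurableType d'}
    (F : V -> V') b S h : (forall Q, Q \in S -> measurable Q) ->
  measurable_fun [set: T] (fun x => F (stepmax b S h x)).
Proof.
elim: S F => [F _|Q S IHS F mS].
  by under eq_fun do rewrite /stepmax big_nil; exact: measurable_cst.
under eq_fun do rewrite /stepmax big_cons (fun_if F).
have {}IHS (F' : V -> V') : measurable_fun [set: T] (fun x => F' (stepmax b S h x)).
  by apply: IHS => P PS; apply: mS; rewrite inE PS orbT.
apply: measurable_fun_ifT.
- apply: (measurable_fun_bool true); rewrite setTI preimage_mem_true.
  by apply: mS; rewrite mem_head.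
- exact: (IHS (F \o Order.max (h Q))).
- exact: IHS.
Qed.

End order.

Context {R : realType}.
Variable mu : {measure set T -> \bar R}.
Variable g : T -> \bar R.
Hypotheses (mg : measurable_fun [set: T] g) (g0 : forall x, 0 <= g x).
Implicit Types (h : set T -> R).

(** At each point the maximum is 0 or one of the values there, so its power is at most the sum of
    their powers. *)
Lemma integral_stepmax_le_sum (p : R) S h : (0 < p)%R ->
  (forall Q, Q \in S -> measurable Q) -> (forall Q, 0 <= h Q)%R ->
  \int[mu]_x ((stepmax 0 S h x `^ p)%:E * g x) <=
  \sum_(Q <- S) (h Q `^ p)%:E * \int[mu]_(x in Q) g x.
Proof.
move=> p0 mS h0.
have mF Q : Q \in S -> measurable_fun [set: T]
    (fun x => (h Q `^ p)%:E * (g \_ Q) x).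
  move=> QS; apply: emeasurable_funM => //.
  by apply/(measurable_restrictT _ _).1; [exact: mS|exact: measurable_funTS].
have F0 Q x : 0 <= (h Q `^ p)%:E * (g \_ Q) x.
  by rewrite mule_ge0 ?lee_fin ?powR_ge0// patchE; case: ifPn.
rewrite big_seq; under eq_bigr => Q QS.
  rewrite integral_mkcond -ge0_integralZl_EFin//; last 3 first.
  - by move=> x _; rewrite patchE; case: ifPn.
  - by apply/(measurable_restrictT _ _).1; [exact: mS|exact: measurable_funTS].
  - exact: powR_ge0.
  over.
rewrite -big_seq.
elim: S mS mF => [mS mF|Q S IHS mS mF].
  rewrite big_nil (eq_integral (cst 0)) ?integral0// => x _.
  by rewrite /stepmax big_nil powR0 ?gt_eqF// mul0e.
have mS' Q' : Q' \in S -> measurable Q'.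
  by move=> Q'S; apply: mS; rewrite inE Q'S orbT.
have mM : measurable_fun [set: T] (fun x => (stepmax 0 S h x `^ p)%:E * g x).
  by apply: emeasurable_funM => //; exact: (measurable_stepmax (fun y => (y `^ p)%:E)).
have M0 x : 0 <= (stepmax 0 S h x `^ p)%:E * g x.
  by rewrite mule_ge0// lee_fin powR_ge0.
rewrite big_cons; apply: le_trans (leeD2l _ (IHS mS' _)); last first.
  by move=> Q' Q'S; apply: mF; rewrite inE Q'S orbT.
rewrite -ge0_integralD//; last exact/mF/mem_head.
apply: ge0_le_integral => //.
- by move=> x _; rewrite mule_ge0// lee_fin powR_ge0.
- by apply: emeasurable_funM => //; exact: (measurable_stepmax (fun y => (y `^ p)%:E)).
- by apply: emeasurable_funD => //; exact/mF/mem_head.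
move=> x _; rewrite {1}/stepmax big_cons -/(stepmax 0%R S h x) patchE.
case: ifPn => xQ; last first.
  by rewrite mule0 add0e.
have [|] := leP (h Q) (stepmax 0%R S h x) => _.
  by rewrite leeDr// mule_ge0// lee_fin powR_ge0.
by rewrite leeDl.
Qed.

(* Peeling off the cube with the smallest value of [h]: iterating this along a
   list sorted by [h] is a layer-cake decomposition. *)
Lemma integral_stepmax_cons (phi : R -> R) b Q S h :
  {in [pred y | b <= y]%R &, {homo phi : x y / x <= y}%R} ->
  (forall P, P \in Q :: S -> measurable P) ->
  (b <= h Q)%R -> (forall P, P \in S -> (h Q <= h P)%R) ->
  \int[mu]_x ((phi (stepmax b (Q :: S) h x) - phi b)%:E * g x) =
  (phi (h Q) - phi b)%:E * \int[mu]_(x in union_of (Q :: S)) g x +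
  \int[mu]_x ((phi (stepmax (h Q) S h x) - phi (h Q))%:E * g x).
Proof.
move=> phi_le mS bQ QS; have mU := measurable_union_of mS.
have mS' P : P \in S -> measurable P.
  by move=> PS; apply: mS; rewrite inE PS orbT.
have phi0 : (0 <= phi (h Q) - phi b)%R.
  by rewrite subr_ge0 phi_le// inE.
have mgU : measurable_fun [set: T] (g \_ (union_of (Q :: S))).
  by apply/(measurable_restrictT _ _).1 => //; exact: measurable_funTS.
have gU0 x : 0 <= (g \_ (union_of (Q :: S))) x by rewrite patchE; case: ifPn.
have M0 x : (0 <= phi (stepmax (h Q) S h x) - phi (h Q))%R.
  rewrite subr_ge0 phi_le ?inE ?stepmax_ge_id//.
  exact: le_trans (stepmax_ge_id _ _ _ _).
rewrite [in RHS]integral_mkcond -ge0_integralZl_EFin// -ge0_integralD//.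
- apply: eq_integral => x _; rewrite patchE; case: ifPn => [|].
    move=> /set_mem Ux; rewrite (stepmax_cons_min bQ QS Ux).
    by rewrite -ge0_muleDl ?lee_fin// -EFinD [in RHS]addrC addrA subrK.
  rewrite notin_setE => Ux; rewrite (stepmax_out _ _ Ux) subrr mul0e mule0 add0e.
  rewrite stepmax_out ?subrr ?mul0e// => -[P PS Px].
  by apply: Ux; exists P => //; rewrite inE PS orbT.
- by move=> x _; rewrite mule_ge0 ?lee_fin.
- exact: emeasurable_funM.
- by move=> x _; rewrite mule_ge0 ?lee_fin.
- apply: emeasurable_funM => //.
  exact: (measurable_stepmax (fun y => (phi y - phi (h Q))%:E)).
Qed.

End step_maximum.

(** * Carleson embedding and Doob's maximal inequality for finite families *)

Section maximal_inequalities.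
Context {d : measure_display} {T : measurableType d} {R : realType}.
Variable mu : {measure set T -> \bar R}.
Implicit Types (S : seq (set T)) (Q : set T) (h : set T -> R).

Lemma sort_by_ind h (P : seq (set T) -> Prop) :
  P [::] ->
  (forall Q S, (forall Q', Q' \in S -> h Q <= h Q')%R -> P S -> P (Q :: S)) ->
  forall S, P (sort (fun Q Q' => h Q <= h Q')%R S).
Proof.
move=> P0 Pcons S.
have : sorted (fun Q Q' => h Q <= h Q')%R (sort (fun Q Q' => h Q <= h Q')%R S).
  by apply: sort_sorted => Q Q'; exact: le_total.
elim: (sort _ S) => // Q S' IHS QS'; apply: Pcons; last exact/IHS/path_sorted/QS'.
have tr : transitive (fun Q Q' => h Q <= h Q')%R by move=> ? ? ?; exact: le_trans.
exact/allP/(order_path_min tr QS').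
Qed.

(** Layer cake in [h]: the lowest layer, of height [h Q - b], costs the total of [a] over the
    remaining cubes, bounded through [g] on their union; the higher layers follow by induction. *)
Lemma carleson_embedding S (a h : set T -> R) (C : R) (g : T -> \bar R) :
  measurable_fun [set: T] g -> (forall x, 0 <= g x) ->
  laminar S -> (forall Q, Q \in S -> measurable Q) ->
  (forall Q, 0 <= a Q)%R -> (forall Q, 0 <= h Q)%R -> (0 <= C)%R ->
  (forall P, P \in S -> (\sum_(Q <- S | `[< Q `<=` P >]) a Q)%R%:E <=
                        C%:E * \int[mu]_(x in P) g x) ->
  (\sum_(Q <- S) a Q * h Q)%R%:E <=
    C%:E * \int[mu]_x ((stepmax 0%R S h x)%:E * g x).
Proof.
move=> mg g0 lam mS a0 h0 C0 carl.
pose le_h := fun Q Q' => (h Q <= h Q')%R.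
have sortS : sort le_h S =i S by move=> Q; rewrite mem_sort.
have psort : perm_eq S (sort le_h S) by rewrite perm_sym perm_sort.
rewrite (eq_stepmax _ _ (fun Q => esym (sortS Q))) (perm_big _ psort)/=.
have : {subset sort le_h S <= S} by move=> Q; rewrite sortS.
have : forall P, P \in sort le_h S ->
    (\sum_(Q <- sort le_h S | `[< Q `<=` P >]) a Q)%R%:E <=
    C%:E * \int[mu]_(x in P) g x.
  by move=> P; rewrite sortS => /carl; rewrite (perm_big _ psort).
(* The base [b] is general because removing the lowest cube [Q] raises it to [h Q]. *)
pose goal_for S' := forall b : R,
    (forall Q, Q \in S' -> b <= h Q)%R ->
    (forall P, P \in S' -> (\sum_(Q <- S' | `[< Q `<=` P >]) a Q)%R%:E <=
                           C%:E * \int[mu]_(x in P) g x) ->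
    {subset S' <= S} ->
    (\sum_(Q <- S') a Q * (h Q - b))%R%:E <=
    C%:E * \int[mu]_x ((stepmax b S' h x - b)%:E * g x).
suff main : goal_for (sort le_h S).
  move=> carl' sub; have := main 0%R (fun Q _ => h0 Q) carl' sub.
  rewrite (eq_bigr (fun Q => a Q * h Q)%R); last by move=> Q _; rewrite subr0.
  by under eq_integral => x _ do rewrite subr0.
apply: (@sort_by_ind h goal_for) => [b _ _ _|Q S' QS' IHS b bS' carl' sub].
  rewrite big_nil mule_ge0 ?lee_fin//; apply: integral_ge0 => x _.
  by rewrite mule_ge0// lee_fin subr_ge0 stepmax_ge_id.
have mS' P : P \in Q :: S' -> measurable P by move=> /sub /mS.
have bQ : (b <= h Q)%R := bS' _ (mem_head _ _).
rewrite (@integral_stepmax_cons _ _ _ mu g mg g0 id)//=.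
rewrite ge0_muleDr; last 2 first.
- by rewrite mule_ge0 ?integral_ge0// lee_fin subr_ge0.
- apply: integral_ge0 => x _.
  by rewrite mule_ge0// lee_fin subr_ge0 stepmax_ge_id.
(* Each height [h P - b] splits into the common layer [h Q - b] and the rest [h P - h Q], which
   vanishes for [Q]. *)
rewrite (_ : (\sum_(P <- _) _)%R = ((h Q - b) * \sum_(P <- Q :: S') a P +
    \sum_(P <- S') a P * (h P - h Q))%R); last first.
  rewrite !big_cons [in RHS]mulrDr -addrA; congr (_ + _)%R; first by rewrite mulrC.
  rewrite mulr_sumr -big_split/=; apply: eq_bigr => P _; ring.
rewrite EFinD; apply: leeD.
  rewrite muleCA EFinM; apply: lee_wpmul2l.
    by rewrite lee_fin subr_ge0.
  apply: carleson_sum => //.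
  - exact: laminar_sub sub lam.
  - exact: measurable_union_of.
  - by move=> P PS; split; [exact: mS'|move=> x Px; exists P].
apply: IHS => // [P PS'|P PS']; last by apply: sub; rewrite inE PS' orbT.
have PS : P \in Q :: S' by rewrite inE PS' orbT.
apply: le_trans (carl' _ PS); rewrite lee_fin big_cons.
by case: ifPn => // _; rewrite lerDr.
Qed.

(* Young's inequality in this form lets a weak-type bound be integrated against
   the discrete layers of a step function. *)
Lemma powR_layer (b c t : R) : (0 <= b)%R -> (b <= c)%R -> (1 < t)%R ->
  (c `^ t - b `^ t <= t / (t - 1) * (c * (c `^ (t - 1) - b `^ (t - 1))))%R.
Proof.
move=> b0 bc t1; have c0 : (0 <= c)%R by apply: le_trans bc.
have t0 : (0 < t)%R by apply: lt_trans t1.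
have t10 : (0 < t - 1)%R by rewrite subr_gt0.
rewrite mulrBr mulr_powRB1//.
have := @conjugate_powR R c (b `^ (t - 1))%R t (t / (t - 1))%R c0 (powR_ge0 _ _) t0.
rewrite divr_gt0// => /(_ isT).
have -> : (t^-1 + (t / (t - 1))^-1 = 1)%R by field; rewrite !gt_eqF.
move=> /(_ erefl).
rewrite -powRrM (_ : (t - 1) * _ = t)%R; last by field; rewrite gt_eqF.
rewrite -[in X in (X -> _)%R](ler_pM2l (x := (t / (t - 1))%R)) ?divr_gt0//.
have -> : (t / (t - 1) * (c `^ t / t + b `^ t / (t / (t - 1))) =
           c `^ t / (t - 1) + b `^ t)%R by field; rewrite !gt_eqF.
have -> : (t / (t - 1) = 1 + (t - 1)^-1)%R by field; rewrite gt_eqF.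
lra.
Qed.

(** Let [M] be the step maximum and [Y] the integral of [M ^ t s]. Summing the weak-type bound over
    the layers bounds [Y] by the integral of [t' M ^ (t - 1) f s]. Where [M >= 2 t' f] this
    integrand is at most [M ^ t s / 2], elsewhere at most a multiple of [f ^ t s], so half of [Y]
    can be absorbed. *)
Lemma doob_inequality (t : R) S h (s f : T -> \bar R) :
  (1 < t)%R ->
  measurable_fun [set: T] s -> (forall x, 0 <= s x) ->
  measurable_fun [set: T] f -> (forall x, 0 <= f x) ->
  laminar S -> (forall Q, Q \in S -> measurable Q) ->
  (forall Q, 0 <= h Q)%R ->
  (forall Q, Q \in S -> \int[mu]_(x in Q) s x < +oo) ->
  (forall Q, Q \in S -> (h Q)%:E * \int[mu]_(x in Q) s x <=
                        \int[mu]_(x in Q) (f x * s x)) ->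
  \int[mu]_x ((stepmax 0%R S h x `^ t)%:E * s x) <=
  ((2 * (t / (t - 1))) `^ t)%:E * \int[mu]_x (f x `^ t * s x).
Proof.
move=> t1 ms s0 mf f0 lam mS h0 sfin avg.
have t0 : (0 < t)%R by apply: lt_trans t1.
have t10 : (0 < t - 1)%R by rewrite subr_gt0.
set t' := (t / (t - 1))%R; have t'0 : (0 < t')%R by rewrite divr_gt0.
have mfs : measurable_fun [set: T] (fun x => f x * s x) by exact: emeasurable_funM.
have fs0 x : 0 <= f x * s x by rewrite mule_ge0.
pose le_h := fun Q Q' => (h Q <= h Q')%R.
have powt (p : R) : (0 <= p)%R ->
    {in [pred y | 0 <= y]%R &, {homo (fun y => y `^ p)%R : x y / (x <= y)%R}}.
  by move=> p0 x y; exact: ge0_ler_powR.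
have step : \int[mu]_x ((stepmax 0%R S h x `^ t)%:E * s x) <=
    t'%:E * \int[mu]_x ((stepmax 0%R S h x `^ (t - 1))%:E * (f x * s x)).
  have sortS : sort le_h S =i S by move=> Q; rewrite mem_sort.
  rewrite (eq_stepmax _ _ (fun Q => esym (sortS Q))).
  have : {subset sort le_h S <= S} by move=> Q; rewrite sortS.
  pose goal_for S' := forall b : R, (0 <= b)%R ->
    (forall Q, Q \in S' -> b <= h Q)%R -> {subset S' <= S} ->
    \int[mu]_x ((stepmax b S' h x `^ t - b `^ t)%:E * s x) <=
    t'%:E * \int[mu]_x ((stepmax b S' h x `^ (t - 1) - b `^ (t - 1))%:E *
                        (f x * s x)).
  suff main : goal_for (sort le_h S).
    move=> sub; have := main 0%R (lexx _) (fun Q _ => h0 Q) sub.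
    rewrite !powR0 ?gt_eqF//; under eq_integral => x _ do rewrite subr0.
    by under [X in _ <= _ * X]eq_integral => x _ do rewrite subr0.
  apply: (@sort_by_ind h goal_for) => [b b0 _ _|Q S' QS' IHS b b0 bS' sub].
    rewrite (eq_integral (cst 0)) ?integral0.
      apply: mule_ge0; first by rewrite lee_fin ltW.
      apply: integral_ge0 => x _.
      by rewrite /stepmax big_nil subrr mul0e.
    by move=> x _; rewrite /stepmax big_nil subrr mul0e.
  have mS' P : P \in Q :: S' -> measurable P by move=> /sub /mS.
  have bQ : (b <= h Q)%R by exact/bS'/mem_head.
  have powtb (p : R) : (0 <= p)%R ->
      {in [pred y | b <= y]%R &, {homo (fun y => y `^ p)%R : x y / (x <= y)%R}}.
    by move=> p0 x y bx yb; apply: powt => //; rewrite inE (le_trans b0).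
  rewrite (@integral_stepmax_cons _ _ _ mu s ms s0 (fun y => y `^ t)%R)//; last first.
    exact/powtb/ltW.
  rewrite (@integral_stepmax_cons _ _ _ mu _ mfs fs0 
    (fun y => y `^ (t - 1))%R)//; last first.
    exact/powtb/ltW.
  have pow_b p x : (0 <= p)%R -> (0 <= stepmax (h Q) S' h x `^ p - h Q `^ p)%R.
    by move=> p0; rewrite subr_ge0 powt ?inE ?stepmax_ge_id//
      (le_trans (h0 Q))// stepmax_ge_id.
  rewrite [leRHS]ge0_muleDr; last 2 first.
  - by rewrite mule_ge0 ?integral_ge0// lee_fin subr_ge0 powtb ?inE// ltW.
  - by apply: integral_ge0 => x _; rewrite mule_ge0// lee_fin pow_b// ltW.
  apply: leeD; last first.
    by apply: IHS => // P PS'; apply: sub; rewrite inE PS' orbT.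
  set U := union_of _; have mU : measurable U by exact: measurable_union_of.
  (* Each cube in the list has a value at least [h Q]; summing over the disjoint maximal ones gives
     the weak-type bound on the union. *)
  have weak : (h Q)%:E * \int[mu]_(x in U) s x <= \int[mu]_(x in U) (f x * s x).
    have [S0 [S0S dS0 covS0]] := laminar_cover (laminar_sub sub lam).
    have S0U P : P \in S0 -> measurable P /\ P `<=` U.
      by move=> /S0S PS; split; [exact: mS'|move=> x Px; exists P].
    apply: (@le_trans _ _ ((h Q)%:E * \sum_(P <- S0) \int[mu]_(x in P) s x)).
      apply: lee_wpmul2l; first by rewrite lee_fin.
      apply: integral_cover_le => // [P /S0U[]//|x [P /covS0[P' P'S PP'] Px]].
      by exists P' => //; exact: PP'.
    rewrite ge0_sume_distrr; last by move=> P _; exact: integral_ge0.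
    apply: le_trans (sum_integral_disjoint_le mu mfs fs0 mU S0U dS0).
    rewrite big_seq [leRHS]big_seq; apply: lee_sum => P PS0.
    have PS := S0S _ PS0; apply: le_trans (avg _ (sub _ PS)).
    apply: lee_wpmul2r; first exact: integral_ge0.
    by move: PS; rewrite lee_fin inE => /predU1P[->|/QS'].
  have hQb : (0 <= h Q `^ (t - 1) - b `^ (t - 1))%R.
    by rewrite subr_ge0 powtb ?inE// ltW.
  apply: (@le_trans _ _ ((t' * (h Q * (h Q `^ (t - 1) - b `^ (t - 1))))%:E *
                         \int[mu]_(x in U) s x)).
    apply: lee_wpmul2r; first exact: integral_ge0.
    by rewrite lee_fin powR_layer.
  rewrite EFinM -muleA; apply: lee_wpmul2l; first by rewrite lee_fin ltW.
  by rewrite mulrC EFinM -muleA; apply: lee_wpmul2l.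
set Y := \int[mu]_x _ in step *.
have mpow p : measurable_fun [set: T] (fun x => (stepmax 0%R S h x `^ p)%:E).
  exact: (measurable_stepmax (fun y => (y `^ p)%:E)).
have mfp : measurable_fun [set: T] (fun x => f x `^ t * s x).
  by apply: emeasurable_funM => //; exact: (measurableT_comp (measurable_poweR t) mf).
have fp0 x : 0 <= f x `^ t * s x by rewrite mule_ge0// poweR_ge0.
have Yfin : Y < +oo.
  apply: le_lt_trans (integral_stepmax_le_sum mu ms s0 t0 mS h0) _.
  rewrite big_seq; apply: lte_sum_pinfty => Q QS.
  by rewrite lte_mul_pinfty ?lee_fin ?powR_ge0// sfin.
have Y0 : 0 <= Y.
  by apply: integral_ge0 => x _; rewrite mule_ge0// lee_fin powR_ge0.
(* Half of the final constant, since subtracting [Y / 2] doubles it. *)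
pose K := ((2 * t') `^ t / 2)%R.
have Kgt0 : (0 < K)%R by rewrite divr_gt0// powR_gt0// mulr_gt0.
have K0 := ltW Kgt0.
have absorb : Y <= K%:E * \int[mu]_x (f x `^ t * s x) + 2^-1%:E * Y.
  apply: le_trans step _.
  rewrite -ge0_integralZl_EFin//; last 3 first.
  - by move=> x _; rewrite mule_ge0// lee_fin powR_ge0.
  - exact: emeasurable_funM.
  - exact: ltW.
  rewrite -(ge0_integralZl_EFin mu measurableT _ mfp)//.
  rewrite -(@ge0_integralZl_EFin _ _ _ mu _ measurableT
    (fun x => _ * s x))//; last 2 first.
  - by move=> x _; rewrite mule_ge0// lee_fin powR_ge0.
  - exact: emeasurable_funM.
  rewrite -ge0_integralD//; last 4 first.
  - by move=> x _; rewrite mule_ge0// lee_fin.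
  - exact: emeasurable_funM.
  - by move=> x _; rewrite !mule_ge0// lee_fin ?powR_ge0.
  - by apply: emeasurable_funM => //; exact: emeasurable_funM.
  apply: ge0_le_integral => //.
  - by move=> x _; rewrite !mule_ge0// lee_fin ?powR_ge0// ltW.
  - by apply: emeasurable_funM => //; exact: emeasurable_funM.
  - apply: emeasurable_funD; first exact: emeasurable_funM.
    by apply: emeasurable_funM => //; exact: emeasurable_funM.
  move=> x _; rewrite !muleA -ge0_muleDl ?mule_ge0 ?lee_fin ?powR_ge0 ?poweR_ge0//.
  apply: lee_wpmul2r => //.
  set m := stepmax _ _ _ _; have m0 : (0 <= m)%R by exact: stepmax_ge_id.
  have := f0 x; case: (f x) => [y|_|//]; last first.
    by rewrite poweRyr ?gt_eqF// [X in _ <= X + _]gt0_muley ?lte_fin// addye// leey.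
  rewrite lee_fin => y0; rewrite poweR_EFin -!EFinM -EFinD lee_fin.
  have [ym|my] := lerP (2 * t' * y) m.
    apply: ler_wpDl; first by rewrite mulr_ge0// powR_ge0.
    rewrite -(mulr_powRB1 m0 t0) -mulrA [(_ * y)%R]mulrC mulrA [leRHS]mulrA.
    by apply: ler_wpM2r; rewrite ?powR_ge0//; lra.
  apply: ler_wpDr; first by rewrite mulr_ge0// powR_ge0.
  have z0 : (0 <= 2 * t' * y)%R by rewrite mulr_ge0// mulr_ge0// ltW.
  have -> : (K * y `^ t = t' * y * (2 * t' * y) `^ (t - 1))%R.
    rewrite /K mulrAC -powRM//; last by rewrite mulr_ge0// ltW.
    by rewrite -(mulr_powRB1 z0 t0); field.
  rewrite mulrAC; apply: ler_wpM2l; first by rewrite mulr_ge0// ltW.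
  by rewrite powt ?inE// ltW.
have Yf : Y \is a fin_num by rewrite ge0_fin_numE.
have I0 : 0 <= \int[mu]_x (f x `^ t * s x) by exact: integral_ge0.
move: I0 absorb; case: (\int[mu]_x (f x `^ t * s x)) => [z z0| |//].
  rewrite -(fineK Yf) -!EFinM -EFinD !lee_fin /K; lra.
by move=> _ _; rewrite gt0_muley ?leey// lte_fin powR_gt0// mulr_gt0.
Qed.

End maximal_inequalities.

(** * Products in [0, +oo] and Hoelder's inequality for several functions *)

Section extended_products.
Context {R : realType}.
Implicit Types (I : Type).

Lemma prode_gt0 I (s : seq I) (F : I -> \bar R) : (forall i, 0 < F i) ->
  0 < \prod_(i <- s) F i.
Proof. by move=> F0; elim/big_ind: _ => // x y; exact: mule_gt0. Qed.

Lemma lee_prod I (s : seq I) (F G : I -> \bar R) :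
  (forall i, 0 <= F i <= G i) -> \prod_(i <- s) F i <= \prod_(i <- s) G i.
Proof.
move=> FG; elim: s => [|i s IHs]; first by rewrite !big_nil.
have /andP[F0 FGi] := FG i.
by rewrite !big_cons lee_pmul// prode_ge0// => j _; case/andP: (FG j).
Qed.

Lemma prode_eqy (I : finType) (F : I -> \bar R) j : (forall i, 0 < F i) ->
  F j = +oo -> \prod_i F i = +oo.
Proof.
move=> F0 Fj; rewrite (bigD1 j)//= Fj gt0_mulye// -big_filter.
exact: prode_gt0.
Qed.

Lemma sume_eqy (I : finType) (F : I -> \bar R) j : (forall i, 0 <= F i) ->
  F j = +oo -> \sum_i F i = +oo.
Proof.
move=> F0 Fj; rewrite (bigD1 j)//= Fj addye//.
by rewrite -ltNye (lt_le_trans ltNy0)// sume_ge0.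
Qed.

Lemma emeasurable_prod d (T : measurableType d) I (s : seq I)
    (F : I -> T -> \bar R) : (forall i, measurable_fun [set: T] (F i)) ->
  measurable_fun [set: T] (fun x => \prod_(i <- s) F i x).
Proof.
move=> mF; elim: s => [|i s IHs].
  by under eq_fun do rewrite big_nil; exact: measurable_cst.
by under eq_fun do rewrite big_cons; exact: emeasurable_funM.
Qed.

Lemma measurable_poweR_comp d (T : measurableType d) (f : T -> \bar R) (p : R) :
  measurable_fun [set: T] f -> measurable_fun [set: T] (fun x => f x `^ p).
Proof. exact: (measurableT_comp (measurable_poweR p)). Qed.

(** The arithmetic-geometric mean is applied pointwise to [g i / G i], with [G i] the integral of
    [g i], and integrated. If some [G j] vanishes then [g j] is zero almost everywhere; if all are
    positive, an infinite [G j] makes the right-hand side infinite. *)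
Lemma hoelder_prod d (T : measurableType d) (mu : {measure set T -> \bar R})
    (D : set T) (I : finType) (c : I -> R) (g : I -> T -> \bar R) :
  measurable D -> (forall i, 0 < c i)%R -> (\sum_i c i = 1)%R ->
  (forall i, measurable_fun [set: T] (g i)) -> (forall i x, 0 <= g i x) ->
  \int[mu]_(x in D) \prod_i g i x `^ c i <=
  \prod_i (\int[mu]_(x in D) g i x) `^ c i.
Proof.
move=> mD c0 c1 mg g0.
have mp : measurable_fun D (fun x => \prod_i g i x `^ c i).
  by apply/measurable_funTS/emeasurable_prod => i; exact: measurable_poweR_comp.
have p0 x : 0 <= \prod_i g i x `^ c i by apply: prode_ge0 => i _; exact: poweR_ge0.
have mgD i : measurable_fun D (g i) by exact: measurable_funTS.
pose G i := \int[mu]_(x in D) g i x.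
have G0 i : 0 <= G i by exact: integral_ge0.
have [/existsP[j /eqP Gj]|/existsPn G_neq0] := boolP [exists i, G i == 0].
  rewrite (_ : \int[mu]_(x in D) _ = 0); first by apply: prode_ge0 => i _; exact: poweR_ge0.
  rewrite (@ge0_ae_eq_integral _ _ _ _ _ _ (cst 0))//; last first.
    have /ae_eq_integral_abs : \int[mu]_(x in D) `|g j x| = 0.
      by rewrite -[RHS]Gj; apply: eq_integral => x _; rewrite gee0_abs.
    move=> /(_ mD (mgD j)); apply: filterS => x /[apply] gj.
    by rewrite (bigD1 j)//= gj poweR0r ?mul0e// gt_eqF.
  exact: integral0.
have Ggt0 i : 0 < G i by rewrite lt0e G_neq0 G0.
have [/existsP[j /eqP Gj]|/existsPn Gfin] := boolP [exists i, G i == +oo].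
  rewrite (@prode_eqy _ (fun i => G i `^ c i) j) ?leey//.
    by move=> i; exact: poweR_gt0.
  by rewrite Gj poweRyr// gt_eqF.
pose z i := fine (G i).
have GE i : G i = (z i)%:E by rewrite fineK// ge0_fin_numE// ltey Gfin.
have z0 i : (0 < z i)%R by rewrite -lte_fin -GE.
rewrite [leRHS](_ : _ = (\prod_i z i `^ c i)%:E); last first.
  by rewrite -prodEFin; apply: eq_bigr => i _; rewrite -/(G i) GE.
set Z := (\prod_i z i `^ c i)%R.
have Z0 : (0 < Z)%R by apply: prodr_gt0 => i _; exact: powR_gt0.
apply: (@le_trans _ _
    (\int[mu]_(x in D) (Z%:E * \sum_i ((c i / z i)%:E * g i x)))).
  apply: ge0_le_integral => //.
    apply: emeasurable_funM => //; apply: emeasurable_sum => i.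
    exact: emeasurable_funM.
  move=> x _; have cz i : (0 < c i / z i)%R by rewrite divr_gt0.
  have [/existsP[j /eqP gj]|/existsPn gfin] := boolP [exists i, g i x == +oo].
    rewrite [X in _ * X](@sume_eqy _ _ j).
    - by rewrite gt0_muley ?leey// lte_fin.
    - by move=> i; rewrite mule_ge0// lee_fin ltW.
    - by rewrite gj gt0_muley// lte_fin.
  pose y i := fine (g i x).
  have gE i : g i x = (y i)%:E by rewrite fineK// ge0_fin_numE// ltey gfin.
  have y0 i : (0 <= y i)%R by rewrite -lee_fin -gE.
  rewrite [leLHS](_ : _ = (\prod_i y i `^ c i)%:E); last first.
    by rewrite -prodEFin; apply: eq_bigr => i _; rewrite gE.
  rewrite [X in _ * X](_ : _ = (\sum_i c i / z i * y i)%:E); last first.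
    by rewrite -sumEFin; apply: eq_bigr => i _; rewrite gE.
  rewrite -EFinM lee_fin.
  rewrite (eq_bigr (fun i => z i `^ c i * (y i / z i) `^ c i)%R); last first.
    move=> i _; rewrite -powRM ?divr_ge0 ?(ltW (z0 i))//.
    by rewrite mulrCA divff ?mulr1 ?gt_eqF.
  rewrite big_split/=; apply: ler_wpM2l; first exact: ltW.
  apply: le_trans (prod_powR_le_sum c0 c1 _) _.
    by move=> i; rewrite divr_ge0// ltW.
  by apply: ler_sum => i _; rewrite mulrAC mulrA.
have mcg i : measurable_fun D (fun x => (c i / z i)%:E * g i x).
  by apply: emeasurable_funM.
have cg0 i x : 0 <= (c i / z i)%:E * g i x.
  by rewrite mule_ge0// lee_fin divr_ge0// ltW.
rewrite ge0_integralZl_EFin//; last 3 first.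
- by move=> x _; apply: sume_ge0.
- exact: emeasurable_sum.
- exact: ltW.
rewrite ge0_integral_sum// (eq_bigr (fun i => (c i)%:E)); last first.
  move=> i _; rewrite ge0_integralZl_EFin//; last by rewrite divr_ge0// ltW.
  by rewrite -/(G i) GE -EFinM divfK// gt_eqF.
by rewrite sumEFin c1 mule1.
Qed.

End extended_products.

(** * Principal cubes and sparseness *)

Section sparse_families.
Context {d : measure_display} {T : measurableType d} {R : realType}.
Implicit Types (S : seq (set T)) (Q P : set T).

(** Cubes are inserted in increasing order of [h]. A cube already dominated is skipped; otherwise it
    becomes principal and replaces the principal cubes inside it, whose values are not larger, so
    what they dominated remains dominated. *)
Lemma principal_subfamily S (h : set T -> R) (a : R) : (1 <= a)%R ->
  (forall Q, 0 <= h Q)%R ->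
  exists S', [/\ uniq S', {subset S' <= S},
    (forall Q, Q \in S -> exists P, [/\ P \in S', Q `<=` P & (h Q <= a * h P)%R]) &
    (forall P Q, P \in S' -> Q \in S' -> Q `<=` P -> Q != P -> (a * h P < h Q)%R)].
Proof.
move=> a1 h0.
pose goal_for S := exists S', [/\ uniq S', {subset S' <= S},
    (forall Q, Q \in S -> exists P, [/\ P \in S', Q `<=` P & (h Q <= a * h P)%R]) &
    (forall P Q, P \in S' -> Q \in S' -> Q `<=` P -> Q != P -> (a * h P < h Q)%R)].
(* Sorting by [- h] puts the largest value at the head, which the induction inserts last. *)
have [] : goal_for (sort (fun Q Q' => - h Q <= - h Q')%R S); last first.
  move=> S' [uS' sub dom prin]; exists S'; split => //.
    by move=> Q /sub; rewrite mem_sort.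
  by move=> Q QS; apply: dom; rewrite mem_sort.
apply: (@sort_by_ind _ _ _ (fun Q => - h Q)%R goal_for).
  by exists [::]; split.
move=> Q {}S QS [S' [uS' sub dom prin]].
have [[P [PS' QP hQP]]|nodom] :=
    pselect (exists P, [/\ P \in S', Q `<=` P & (h Q <= a * h P)%R]).
  exists S'; split => //; first by move=> Q' /sub; rewrite inE orbC => ->.
  by move=> Q'; rewrite inE => /predU1P[->|/dom//]; exists P.
exists (Q :: [seq P <- S' | ~~ `[< P `<=` Q >]]); split.
- rewrite /= filter_uniq// andbT mem_filter negb_and negbK; apply/orP; left.
  exact/asboolP.
- by move=> P; rewrite !inE mem_filter => /predU1P[->|/andP[_ /sub ->]];
    rewrite ?eqxx ?orbT.
- move=> Q'; rewrite inE => /predU1P[->|Q'S].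
    by exists Q; rewrite mem_head; split => //; rewrite ler_peMl.
  have [P [PS' Q'P hQ'P]] := dom _ Q'S.
  have [PQ|nPQ] := pselect (P `<=` Q).
    exists Q; rewrite mem_head; split => //; first exact: subset_trans PQ.
    have := QS _ Q'S; rewrite lerN2 => /le_trans; apply.
    by rewrite ler_peMl.
  exists P; split => //; rewrite inE mem_filter PS' andbT; apply/orP; right.
  exact/asboolPn.
- move=> P Q'; rewrite !inE !mem_filter.
  move=> /predU1P[->|/andP[/asboolPn nPQ PS']] /predU1P[->|/andP[/asboolPn nQ'Q Q'S']] //.
  + by rewrite eqxx.
  + move=> QP _; rewrite ltNge; apply/negP => hQP; apply: nodom.
    by exists P.
  + exact: prin.
Qed.

(** The maximal proper subcubes of [P] carry at most half of its mass, and by induction the cubes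
    below each of them at most twice its mass. Together this is at most [m P], to which [P] adds
    [m P]. The induction is on the number of cubes inside [P]. *)
Lemma sparse_sum_le S (m : set T -> R) : uniq S -> laminar S ->
  (forall Q, 0 <= m Q)%R ->
  (forall P S0, P \in S -> disjoint_family S0 ->
    (forall Q, Q \in S0 -> [/\ Q \in S, Q `<=` P & Q != P]) ->
    (2 * \sum_(Q <- S0) m Q <= m P)%R) ->
  forall P, P \in S -> (\sum_(Q <- S | `[< Q `<=` P >]) m Q <= 2 * m P)%R.
Proof.
move=> uS lam m0 half.
suff main n P : P \in S -> (size [seq Q <- S | `[< Q `<=` P >]] <= n)%N ->
    (\sum_(Q <- S | `[< Q `<=` P >]) m Q <= 2 * m P)%R.
  by move=> P PS; exact: main (leqnn _).
elim: n P => [P PS|n IHn P PS szP].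
  rewrite leqn0 size_eq0 => /eqP SP.
  have : P \in [seq Q <- S | `[< Q `<=` P >]].
    by rewrite mem_filter PS andbT; apply/asboolP.
  by rewrite SP.
pose S1 := [seq Q <- S | `[< Q `<=` P >] & Q != P].
have S1P Q : Q \in S1 -> [/\ Q \in S, Q `<=` P & Q != P].
  by rewrite mem_filter => /andP[/andP[/asboolP ? ?] ?].
have S1S : {subset S1 <= S} by move=> Q /S1P[].
have [S0 [S0S1 dS0 covS0]] := laminar_cover (laminar_sub S1S lam).
have -> : (\sum_(Q <- S | `[< Q `<=` P >]) m Q = m P + \sum_(Q <- S1) m Q)%R.
  rewrite -big_filter (bigD1_seq P) ?filter_uniq//=.
    by rewrite big_filter_cond big_filter.
  by rewrite mem_filter PS andbT; exact/asboolP.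
suff : (\sum_(Q <- S1) m Q <= m P)%R by lra.
apply: le_trans (sum_le_cover m0 covS0) _.
have := half P S0 PS dS0 (fun Q QS0 => S1P _ (S0S1 _ QS0)).
apply: le_trans; rewrite mulr_sumr big_seq [leRHS]big_seq; apply: ler_sum => Q QS0.
have [QS QP QneqP] := S1P _ (S0S1 _ QS0).
apply: (@le_trans _ _ (\sum_(Q' <- S | `[< Q' `<=` Q >]) m Q')%R).
  rewrite big_filter_cond [leLHS]big_mkcond [leRHS]big_mkcond/=; apply: ler_sum => Q' _.
  by case: ifPn => [/andP[_ ->]//|_]; case: ifPn.
apply: IHn => //; rewrite -ltnS; apply: leq_trans szP.
apply: (@uniq_leq_size _ (P :: _)).
  rewrite /= filter_uniq// andbT mem_filter negb_and; apply/orP; left.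
  apply/asboolPn => PQ; move/eqP: QneqP; apply; exact/seteqP.
move=> Q'; rewrite inE !mem_filter => /predU1P[->|/andP[/asboolP Q'Q ->]].
  by rewrite PS andbT; apply/asboolP.
by rewrite andbT; apply/asboolP/(subset_trans Q'Q).
Qed.

End sparse_families.

(** * Estimates on a single cube, mostly in logarithms *)

Section logarithmic_estimates.
Context {R : realType} {n : nat}.
Local Open Scope ring_scope.
Variables r rho t : 'I_n -> R.
Hypotheses (hr : forall i, 0 < r i) (ht : forall i, 1 < t i)
  (hrho0 : forall i, 0 <= rho i)
  (htrho : forall i, rho i < (t i)^-1).

Local Notation beta := (fun i => r i * ((t i)^-1 - rho i)).
Local Notation alpha := (\sum_i beta i).
Local Notation gamma := (\sum_i r i * (1 - rho i)).

Let t_gt0 i : 0 < t i. Proof. exact: lt_trans (ht i). Qed.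

Lemma beta_gt0 i : 0 < beta i.
Proof. by rewrite mulr_gt0// subr_gt0. Qed.

(** The term of the maximal operator for a cube of measure [m] on which the functions have integrals
    [G]. *)
Let lam (m : R) (G : 'I_n -> R) :=
  \prod_i (m `^ (- (1 - rho i)) * G i) `^ r i.

Let lamE m G : 0 < m -> (forall i, 0 < G i) ->
  lam m G = expR (\sum_i r i * (- (1 - rho i) * ln m + ln (G i))).
Proof.
move=> m0 G0; rewrite /lam prod_powR_expR; last by move=> i; rewrite mulr_gt0 ?powR_gt0.
by congr expR; apply: eq_bigr => i _; rewrite lnM ?posrE ?powR_gt0// ln_powR.
Qed.

(* [G], [b], [s], [W], [m] stand for the integrals over a cube of [f v],
   [f ^ t v], [v], [w] and [1]. *)
Variables (m W A : R) (s G : 'I_n -> R).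
Hypotheses (m0 : 0 < m) (W0 : 0 < W) (s0 : forall i, 0 < s i)
  (G0 : forall i, 0 < G i)
  (muck : (\prod_i (s i / m) `^ (r i * (1 - (t i)^-1))) * (W / m) `^ alpha <= A).

(** The exponent [alpha] of [W / m] is distributed over the [beta i], so that the estimates below
    reduce to one inequality for each [i]. *)
Let ln_muck : \sum_i (r i * (1 - (t i)^-1) * (ln (s i) - ln m) +
                      beta i * (ln W - ln m)) <= ln A.
Proof.
rewrite big_split/= -mulr_suml -[leLHS]expRK ler_ln ?posrE ?expR_gt0//.
  apply: le_trans muck; rewrite prod_powR_expR; last by move=> i; rewrite divr_gt0.
  rewrite expRD /powR gt_eqF ?divr_gt0// ln_div ?posrE//.
  by under [in leRHS]eq_bigr do rewrite ln_div ?posrE//.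
apply: lt_le_trans muck; rewrite mulr_gt0 ?powR_gt0 ?divr_gt0//.
by apply: prodr_gt0 => i _; rewrite powR_gt0// divr_gt0.
Qed.

Let A0 : 0 < A.
Proof.
apply: lt_le_trans muck; rewrite mulr_gt0 ?powR_gt0 ?divr_gt0//.
by apply: prodr_gt0 => i _; rewrite powR_gt0// divr_gt0.
Qed.

(** In logarithms, once the Muckenhoupt bound is used, the two sides differ by the sum of
    [r i / t i] times the slack in Hoelder's inequality [G ^ t <= b * s ^ (t - 1)]. *)
Lemma weak_type_cube (b : 'I_n -> R) : (forall i, 0 < b i) ->
  (forall i, t i * ln (G i) <= ln (b i) + (t i - 1) * ln (s i)) ->
  lam m G * W `^ alpha <= A * \prod_i b i `^ (r i / t i).
Proof.
move=> b0 Gb; rewrite lamE// prod_powR_expR// /powR gt_eqF//.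
rewrite -[A]lnK ?posrE// -!expRD ler_expR mulr_suml -big_split/=.
apply: le_trans (lerD ln_muck (lexx _)); rewrite -big_split/=; apply: ler_sum => i _.
rewrite -subr_ge0 [leRHS](_ : _ = r i / t i *
    (ln (b i) + (t i - 1) * ln (s i) - t i * ln (G i))).
  by rewrite mulr_ge0 ?subr_ge0// divr_ge0// ltW.
by field; rewrite gt_eqF.
Qed.

(** The factors are the Muckenhoupt bound, the measure times the geometric mean of the averages of
    the weights, and powers of the averages [G i / s i] of [f i] with respect to [v i]. The
    fractional exponents are paid for by [rho i * r i] times the slack in Hoelder's inequality. *)
Lemma strong_type_cube (B : 'I_n -> R) : 0 < alpha -> (forall i, 0 < B i) ->
  (forall i, t i * ln (G i) <= ln (B i) + (t i - 1) * ln (s i)) ->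
  lam m G `^ alpha^-1 * W <=
  A `^ alpha^-1 * ((m * \prod_i (s i / m) `^ (beta i / alpha)) *
    \prod_i (B i `^ (rho i * r i / alpha) *
             (G i / s i) `^ (t i * beta i / alpha))).
Proof.
set a := alpha => a0 B0 GB; have a_neq0 : a != 0 by rewrite gt_eqF.
rewrite lamE// big_split/= !prod_powR_expR//; last 2 first.
- by move=> i; rewrite divr_gt0.
- by move=> i; rewrite divr_gt0.
rewrite /powR !gt_eqF ?expR_gt0// expRK -[W]lnK ?posrE//.
rewrite -[X in _ <= _ * (X * _ * _)]lnK ?posrE// -!expRD ler_expR.
rewrite -(ler_pM2l a0) !mulrDr !mulr_sumr.
have -> : \sum_(i < n) a * (a^-1 * (r i * (- (1 - rho i) * ln m + ln (G i)))) =
          \sum_i r i * (- (1 - rho i) * ln m + ln (G i)).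
  by apply: eq_bigr => i _; rewrite mulrA mulfV// mul1r.
have -> : a * (a^-1 * ln A) = ln A by rewrite mulrA mulfV// mul1r.
have -> : \sum_i a * (r i * ((t i)^-1 - rho i) / a * ln (s i / m)) =
          \sum_i beta i * (ln (s i) - ln m).
  by apply: eq_bigr => i _; rewrite ln_div ?posrE//; field; rewrite a_neq0 gt_eqF.
have -> : \sum_i a * (rho i * r i / a * ln (B i)) =
          \sum_i rho i * r i * ln (B i).
  by apply: eq_bigr => i _; field.
have -> : \sum_i a * (t i * (r i * ((t i)^-1 - rho i)) / a * ln (G i / s i)) =
          \sum_i t i * beta i * (ln (G i) - ln (s i)).
  by apply: eq_bigr => i _; rewrite ln_div ?posrE//; field; rewrite a_neq0 gt_eqF.
apply: le_trans (lerD ln_muck (lexx _)); rewrite /a !mulr_suml -!big_split/=.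
apply: ler_sum => i _; rewrite -subr_ge0.
rewrite [leRHS](_ : _ = rho i * r i *
    (ln (B i) + (t i - 1) * ln (s i) - t i * ln (G i))).
  by rewrite mulr_ge0 ?subr_ge0// mulr_ge0// ltW.
by field; rewrite gt_eqF.
Qed.

(** [gamma] is the degree of [lam] in [1 / m], so a jump of [lam] by [2 ^ gamma] becomes a factor 2
    on the measure after taking roots. The exponents [r i / gamma] add up to at least 1, which lets
    the bound be summed over disjoint cubes. *)
Lemma stopping_cube (m' : R) (G' : 'I_n -> R) : 0 < gamma -> 0 < m' ->
  (forall i, 0 < G' i) ->
  2 `^ gamma * lam m G < lam m' G' ->
  2 * m' <= m * \prod_i (G' i / G i) `^ (r i / gamma).
Proof.
set c := gamma => c0 m'0 G'0; have c_neq0 : c != 0 by rewrite gt_eqF.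
rewrite !lamE// prod_powR_expR; last by move=> i; rewrite divr_gt0.
rewrite /powR gt_eqF// -[2 in leLHS]lnK ?posrE// -[in leLHS](lnK (x := m')) ?posrE//.
rewrite -[m in leRHS]lnK ?posrE// -!expRD ltr_expR ler_expR => stop.
rewrite -(ler_pM2l c0) !mulrDr mulr_sumr.
have -> : \sum_(i < n) c * (r i / c * ln (G' i / G i)) =
          \sum_i r i * (ln (G' i) - ln (G i)).
  by apply: eq_bigr => i _; rewrite ln_div ?posrE//; field.
have mE (z : R) (H : 'I_n -> R) :
    \sum_i r i * (- (1 - rho i) * ln z + ln (H i)) =
    - (c * ln z) + \sum_i r i * ln (H i).
  rewrite mulr_suml -sumrN -big_split/=; apply: eq_bigr => i _; ring.
have -> : \sum_i r i * (ln (G' i) - ln (G i)) =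
          \sum_i r i * ln (G' i) - \sum_i r i * ln (G i).
  by rewrite -sumrB; apply: eq_bigr => i _; ring.
move: stop; rewrite !mE; lra.
Qed.

End logarithmic_estimates.

(** The factorization [f v = (f ^ t v) ^ (1 / t) * v ^ (1 - 1 / t)], with [hoelder_prod] over a
    two-element index. *)
Lemma hoelder_power d (T : measurableType d) (R : realType)
    (mu : {measure set T -> \bar R}) (Q : set T) (t : R) (f v : T -> \bar R) :
  (1 < t)%R -> measurable Q ->
  measurable_fun [set: T] f -> (forall x, 0 <= f x) ->
  measurable_fun [set: T] v -> (forall x, 0 <= v x) ->
  \int[mu]_(x in Q) (f x * v x) <=
  (\int[mu]_(x in Q) (f x `^ t * v x)) `^ t^-1 *
  (\int[mu]_(x in Q) v x) `^ (1 - t^-1).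
Proof.
move=> t1 mQ mf f0 mv v0; have t0 : (0 < t)%R by apply: lt_trans t1.
pose c b := (if b then t^-1 else 1 - t^-1)%R.
pose g b x := if b then f x `^ t * v x else v x.
have c0 b : (0 < c b)%R.
  by case: b; rewrite /= ?invr_gt0// subr_gt0 invf_lt1.
have := @hoelder_prod R d T mu Q _ c g mQ c0.
rewrite !big_bool /= subrKC => /(_ erefl); under eq_integral => x _.
  rewrite big_bool/= poweRM ?poweR_ge0// -poweRrM divff ?gt_eqF// poweRe1//.
  rewrite -muleA -poweRD ?subrKC ?poweRe1//; last first.
    by rewrite add_neq0_poweRD_def// subrKC oner_neq0.
  over.
apply; last by case=> x //=; rewrite mule_ge0 ?poweR_ge0.
by case=> //=; apply: emeasurable_funM => //; exact: measurable_poweR_comp.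
Qed.

(** * Weak and strong type estimates for finite families of good cubes *)

Section finite_families_of_cubes.
Context {R : realType} {n : nat}.
Variables r rho t : 'I_n -> R.
Hypotheses (hr : forall i, (0 < r i)%R) (ht : forall i, (1 < t i)%R)
  (hrho0 : forall i, (0 <= rho i)%R)
  (htrho : forall i, (rho i < (t i)^-1)%R).

Local Notation beta := (fun i => r i * ((t i)^-1 - rho i))%R.
Local Notation alpha := (\sum_i beta i)%R.
Local Notation gamma := (\sum_i r i * (1 - rho i))%R.
Hypothesis alpha_gt0 : (0 < alpha)%R.

Context {d : measure_display} {T : measurableType d}.
Variable mu : {measure set T -> \bar R}.
Variables (f v : 'I_n -> T -> \bar R) (w : T -> \bar R).
Hypotheses (nf : forall i, nonneg_measurable (f i))
  (nv : forall i, nonneg_measurable (v i)) (nw : nonneg_measurable w).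

Local Notation fv i := (fun x => (f i x * v i x)%E).
Local Notation ftv i := (fun x => (f i x `^ t i * v i x)%E).

(** An infinite integral becomes 0 here; on good cubes, for finite energies, the integrals in use
    are finite. *)
Definition mass (g : T -> \bar R) (Q : set T) : R :=
  fine (\int[mu]_(x in Q) g x).

Definition cube_value (Q : set T) : R :=
  (\prod_i (fine (mu Q) `^ (- (1 - rho i)) * mass (fv i) Q)
     `^ r i)%R.

Definition muckenhoupt_cube (Q : set T) : R :=
  ((\prod_i (mass (v i) Q / fine (mu Q)) `^ (r i * (1 - (t i)^-1))) *
   (mass w Q / fine (mu Q)) `^ alpha)%R.

(** Cubes on which the logarithms above make sense. Finiteness of the integrals of [f i * v i] comes
    from Hoelder's inequality when the energies are finite. *)
Definition good_cube (Q : set T) := [/\ measurable Q, 0 < mu Q < +oo,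
  0 < \int[mu]_(x in Q) w x < +oo,
  (forall i, 0 < \int[mu]_(x in Q) v i x < +oo) &
  (forall i, 0 < \int[mu]_(x in Q) (f i x * v i x))].

Definition energy i := \int[mu]_x (f i x `^ t i * v i x).

Hypothesis energy_fin : forall i, energy i < +oo.

Let nfv i : nonneg_measurable (fv i).
Proof.
split; first by apply: emeasurable_funM; [exact: (nf i).1|exact: (nv i).1].
by move=> x; rewrite mule_ge0//; [exact: (nf i).2|exact: (nv i).2].
Qed.

Let nft i : nonneg_measurable (ftv i).
Proof.
split.
  by apply: emeasurable_funM; [exact: measurable_poweR_comp (nf i).1|exact: (nv i).1].
by move=> x; rewrite mule_ge0 ?poweR_ge0//; exact: (nv i).2.
Qed.

Lemma mass_ge0 g Q : nonneg_measurable g -> (0 <= mass g Q)%R.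
Proof. by move=> [_ g0]; rewrite fine_ge0// integral_ge0. Qed.

Lemma massE g Q : 0 < \int[mu]_(x in Q) g x < +oo ->
  \int[mu]_(x in Q) g x = (mass g Q)%:E.
Proof. by move=> /andP[g0 gy]; rewrite fineK// ge0_fin_numE// ltW. Qed.

Lemma mass_gt0 g Q : 0 < \int[mu]_(x in Q) g x < +oo -> (0 < mass g Q)%R.
Proof. by move=> gQ; rewrite fine_gt0. Qed.

(** Hoelder's inequality in logarithmic form. It also makes the integral of [f i ^ t i * v i]
    positive, since otherwise that of [f i * v i] would vanish. *)
Lemma good_cube_power i Q : good_cube Q ->
  [/\ 0 < \int[mu]_(x in Q) (f i x `^ t i * v i x) < +oo,
      0 < \int[mu]_(x in Q) (f i x * v i x) < +oo &
      (t i * ln (mass (fv i) Q) <=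
       ln (mass (ftv i) Q) +
       (t i - 1) * ln (mass (v i) Q))%R].
Proof.
move=> [mQ _ _ /(_ i) vQ /(_ i) fvQ].
have t0 : (0 < t i)%R by apply: lt_trans (ht i).
have := hoelder_power mu (ht i) mQ (nf i).1 (nf i).2 (nv i).1 (nv i).2.
have [mft ft0] := nft i.
have Bfin : \int[mu]_(x in Q) (f i x `^ t i * v i x) < +oo.
  by apply: le_lt_trans (energy_fin i); exact: ge0_subset_integral.
have B0 : 0 <= \int[mu]_(x in Q) (f i x `^ t i * v i x) by exact: integral_ge0.
move: (B0); rewrite le_eqVlt => /predU1P[<-|Bgt0].
  rewrite poweR0r ?mul0e; last by rewrite gt_eqF// invr_gt0.
  by rewrite leNgt fvQ.
have BQ : 0 < \int[mu]_(x in Q) (f i x `^ t i * v i x) < +oo by rewrite Bgt0.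
rewrite (massE vQ) (massE BQ) !poweR_EFin -EFinM => le_fv.
have {}fvQ : 0 < \int[mu]_(x in Q) (f i x * v i x) < +oo.
  by rewrite fvQ (le_lt_trans le_fv) ?ltry.
split => //; first by rewrite lte_fin (mass_gt0 BQ) ltry.
move: le_fv; rewrite (massE fvQ) lee_fin => le_fv.
have b0 := mass_gt0 BQ; have s0 := mass_gt0 vQ; have G0 := mass_gt0 fvQ.
have : (ln (mass (fv i) Q) <=
    ln (mass (ftv i) Q `^ (t i)^-1 * mass (v i) Q `^ (1 - (t i)^-1)))%R.
  by rewrite ler_ln ?posrE// mulr_gt0// powR_gt0.
rewrite lnM ?posrE ?powR_gt0// !ln_powR -[in X in X -> _](ler_pM2l t0).
move=> /le_trans; apply; rewrite le_eqVlt; apply/orP; left; apply/eqP; field.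
by rewrite gt_eqF.
Qed.

Lemma cube_value_ge0 Q : (0 <= cube_value Q)%R.
Proof. by apply: prodr_ge0 => i _; exact: powR_ge0. Qed.

Section family.
Variables (S : seq (set T)) (A : R).
Hypotheses (lamS : laminar S) (goodS : forall Q, Q \in S -> good_cube Q)
  (muckS : forall Q, Q \in S -> (muckenhoupt_cube Q <= A)%R).

Let mu_gt0 Q : Q \in S -> (0 < fine (mu Q))%R.
Proof. by move=> /goodS[_ muQ _ _ _]; rewrite fine_gt0. Qed.

(** The level set is covered by disjoint maximal cubes of value above [l]; on each, [weak_type_cube]
    bounds the mass of [w], and the bounds are summed by the Hoelder inequality for sums. *)
Lemma weak_type_family (l : R) : (0 < l)%R ->
  \int[mu]_(x in [set x | l < stepmax 0 S cube_value x]%R) w x <=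
  ((A / l) `^ alpha^-1 * \prod_i fine (energy i) `^ (r i / t i / alpha))%:E.
Proof.
move=> l0.
pose S1 := [seq Q <- S | (l < cube_value Q)%R].
have S1S : {subset S1 <= S} by move=> Q; rewrite mem_filter => /andP[].
have [S0 [S0S1 dS0 covS0]] := laminar_cover (laminar_sub S1S lamS).
have S0S Q : Q \in S0 -> Q \in S by move=> /S0S1 /S1S.
have mS Q : Q \in S -> measurable Q by move=> /goodS[].
have [mw w0] := nw.
apply: (@le_trans _ _ (\sum_(Q <- S0) \int[mu]_(x in Q) w x)).
  apply: integral_cover_le => //.
  - rewrite -[X in measurable X]setTI.
    have := @measurable_stepmax _ T _ _ _ _ (fun y : R => (l < y)%R) 0%R S cube_value mS.
    by move=> /(_ measurableT [set true] I); rewrite preimage_true.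
  - by move=> Q /S0S /mS.
  move=> x /= lx; apply: contrapT => nS0; move: lx; apply/negP; rewrite -leNgt.
  apply: stepmax_le; first exact: ltW.
  move=> Q QS Qx; rewrite leNgt; apply/negP => lQ; apply: nS0.
  have [|P PS0 QP] := covS0 Q; first by rewrite mem_filter lQ.
  by exists P => //; exact: QP.
rewrite big_seq (eq_bigr (fun Q => (mass w Q)%:E)); last first.
  by move=> Q /S0S /goodS[_ _ wQ _ _]; exact: massE.
rewrite -big_seq sumEFin lee_fin.
pose b i Q := mass (ftv i) Q.
apply: (@le_trans _ _ (\sum_(Q <- S0) (A / l) `^ alpha^-1 *
    \prod_i b i Q `^ (r i / t i / alpha))%R).
  rewrite big_seq [leRHS]big_seq; apply: ler_sum => Q QS0.
  have QS := S0S _ QS0; have gQ := goodS QS; have [_ _ wQ vQ _] := gQ.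
  have lQ : (l < cube_value Q)%R.
    by have := S0S1 _ QS0; rewrite mem_filter => /andP[].
  have W0 := mass_gt0 wQ.
  have b0 i : (0 < b i Q)%R by have [/mass_gt0] := good_cube_power i gQ.
  have G0 i : (0 < mass (fv i) Q)%R by have [_ /mass_gt0] := good_cube_power i gQ.
  have Gb i : (t i * ln (mass (fv i) Q) <=
      ln (b i Q) + (t i - 1) * ln (mass (v i) Q))%R.
    by have [] := good_cube_power i gQ.
  have := weak_type_cube hr ht (mu_gt0 QS) W0 (fun i => mass_gt0 (vQ i))
    G0 (muckS QS) b0 Gb.
  rewrite -/(cube_value Q) => key.
  have {key} : (l * mass w Q `^ alpha <= A * \prod_i b i Q `^ (r i / t i))%R.
    by apply: le_trans key; rewrite ler_wpM2r ?powR_ge0// ltW.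
  rewrite mulrC -ler_pdivlMr// mulrAC => key.
  have A0 : (0 <= A)%R.
    apply: le_trans (muckS QS); rewrite mulr_ge0 ?powR_ge0//.
    by apply: prodr_ge0 => i _; exact: powR_ge0.
  have P0 : (0 <= \prod_i b i Q `^ (r i / t i))%R.
    by apply: prodr_ge0 => i _; exact: powR_ge0.
  have p0 : (0 <= alpha^-1)%R by rewrite invr_ge0 ltW.
  have := ge0_ler_powR p0 _ _ key.
  rewrite !nnegrE powR_ge0 mulr_ge0 ?divr_ge0 ?(ltW l0)// => /(_ isT isT).
  rewrite -powRrM divff ?gt_eqF// powRr1 ?(ltW W0)// => /le_trans; apply.
  rewrite [leLHS]powRM ?divr_ge0 ?(ltW l0)//; apply: ler_wpM2l; first exact: powR_ge0.
  rewrite powR_prod; last by move=> i; exact: powR_ge0.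
  by under eq_bigr do rewrite -powRrM.
rewrite -mulr_sumr; apply: ler_wpM2l; first exact: powR_ge0.
have c0 i : (0 < r i / t i / alpha)%R.
  by rewrite divr_gt0// divr_gt0// (lt_trans _ (ht i)).
(* Since [beta i <= r i / t i], the exponents add up to at least 1. *)
apply: le_trans (sum_prod_powR_le _ c0 _ _) _.
- rewrite -mulr_suml ler_pdivlMr// mul1r; apply: ler_sum => i _.
  by rewrite ler_wpM2l ?(ltW (hr i))// gerBl.
- by move=> i Q; exact/mass_ge0/nft.
apply: ler_prod => i _; rewrite powR_ge0/=.
apply: ge0_ler_powR; rewrite ?nnegrE ?(ltW (c0 i))//.
- by rewrite sumr_ge0// => Q _; exact/mass_ge0/nft.
- by rewrite fine_ge0// integral_ge0// => x _; exact: (nft i).2.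
have [mft ft0] := nft i.
rewrite -lee_fin fineK; last by rewrite ge0_fin_numE ?energy_fin// integral_ge0.
rewrite -sumEFin big_seq (eq_bigr (fun Q => \int[mu]_(x in Q) (ftv i x))); last first.
  by move=> Q /S0S /goodS /(good_cube_power i)[ftQ _ _]; rewrite massE.
rewrite -big_seq; apply: sum_integral_disjoint_le => // Q /S0S /mS mQ.
by split.
Qed.

(** The [h Q] of the overview; for [Q] inside [P] it is a term of the maximal function localized to
    [P] in the Fujii-Wilson characteristic. *)
Definition density (Q : set T) : R :=
  (\prod_i (mass (v i) Q / fine (mu Q)) `^ (beta i / alpha))%R.

Lemma density_ge0 Q : (0 <= density Q)%R.
Proof. by apply: prodr_ge0 => i _; exact: powR_ge0. Qed.

(** [K] stands for the Fujii-Wilson characteristic to the power [1 / alpha]. In the bound,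
    [2 ^ gamma] is the loss in passing to principal cubes, the factor 2 before [K] is the sparseness
    constant, and the remaining constants come from Doob's inequality. *)
Lemma strong_type_family (K : R) : (0 <= K)%R ->
  (forall P S', P \in S -> (forall Q, Q \in S' -> Q \in S /\ Q `<=` P) ->
    \int[mu]_x (stepmax 0%R S' density x)%:E <=
    K%:E * \int[mu]_(x in P) \prod_i v i x `^ (beta i / alpha)) ->
  \int[mu]_x ((stepmax 0%R S cube_value x `^ alpha^-1)%:E * w x) <=
  ((2 `^ gamma) `^ alpha^-1 * (A `^ alpha^-1 * (2 * K *
    \prod_i (fine (energy i) `^ (rho i * r i / alpha) *
      ((2 * (t i / (t i - 1))) `^ t i * fine (energy i)) `^ (beta i / alpha)))))%:E.
Proof.
move=> K0 hFW; have [mw w0] := nw.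
have mS Q : Q \in S -> measurable Q by move=> /goodS[].
have gamma_gt0 : (0 < gamma)%R.
  apply: lt_le_trans alpha_gt0 _; apply: ler_sum => i _.
  rewrite ler_wpM2l ?(ltW (hr i))// lerD2r invf_le1 ?(ltW (ht i))//.
  exact: lt_trans (ht i).
have p0 : (0 < alpha^-1)%R by rewrite invr_gt0.
have a1 : (1 <= 2 `^ gamma :> R)%R.
  by have := ler_powR (ler1n R 2) (ltW gamma_gt0); rewrite powRr0.
(* The ratio [2 ^ gamma] is the jump that [stopping_cube] turns into a factor 2 on measures. *)
have [S' [uS' S'S domS' prinS']] := principal_subfamily S a1 cube_value_ge0.
have lamS' := laminar_sub S'S lamS.
have mS' Q : Q \in S' -> measurable Q by move=> /S'S /mS.
pose m Q := fine (mu Q).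
have m_ge0 Q : (0 <= m Q)%R by rewrite fine_ge0.
have muE Q : Q \in S' -> mu Q = (m Q)%:E.
  move=> /S'S /goodS[_ /andP[_ muQ] _ _ _].
  by rewrite fineK// ge0_fin_numE.
have G0 i Q : Q \in S' -> (0 < mass (fv i) Q)%R.
  by move=> /S'S /goodS /(good_cube_power i)[_ /mass_gt0].
(* Disjoint principal cubes properly inside [P] fill at most half of it: [stopping_cube] is summed,
   and the masses of [f i * v i] on them add up to at most the mass on [P]. *)
have sparse : forall P, P \in S' ->
    (\sum_(Q <- S' | `[< Q `<=` P >]) m Q <= 2 * m P)%R.
  apply: sparse_sum_le => // P S0 PS' dS0 S0P.
  have mP := mS' _ PS'.
  have c0 i : (0 < r i / gamma)%R by rewrite divr_gt0.
  rewrite mulr_sumr; apply: (@le_trans _ _ (\sum_(Q <- S0)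
      m P * \prod_i (mass (fv i) Q / mass (fv i) P) `^ (r i / gamma))%R).
    rewrite big_seq [leRHS]big_seq; apply: ler_sum => Q /S0P[QS' QP QneqP].
    apply: (stopping_cube (rho := rho)) => //.
    - exact/mu_gt0/S'S.
    - by move=> i; exact: G0.
    - exact/mu_gt0/S'S.
    - by move=> i; exact: G0.
    - exact: prinS'.
  rewrite -mulr_sumr ler_piMr//.
  apply: le_trans (sum_prod_powR_le _ c0 _ _) _.
  - rewrite -mulr_suml ler_pdivlMr// mul1r; apply: ler_sum => i _.
    by rewrite ler_piMr ?(ltW (hr i))// gerBl.
  - by move=> i Q; rewrite divr_ge0//; exact: (mass_ge0 _ (nfv i)).
  rewrite [leRHS](_ : _ = \prod_(i < n) 1)%R; last by rewrite big1.
  apply: ler_prod => i _; rewrite powR_ge0/=.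
  rewrite -[leRHS](congr1 (@^~ (r i / gamma)%R) (powR1 R)).
  apply: ge0_ler_powR; rewrite ?nnegrE ?(ltW (c0 i))//.
    by rewrite sumr_ge0// => Q _; rewrite divr_ge0//; exact: (mass_ge0 _ (nfv i)).
  rewrite -mulr_suml ler_pdivrMr ?G0// mul1r -lee_fin -sumEFin.
  have [mfv fv0] := nfv i.
  have fvE Q : Q \in S' -> \int[mu]_(x in Q) (fv i x) = (mass (fv i) Q)%:E.
    by move=> /S'S /goodS /(good_cube_power i)[_ /massE].
  rewrite -(fvE _ PS') big_seq (eq_bigr (fun Q => \int[mu]_(x in Q) (fv i x))); last first.
    by move=> Q /S0P[/fvE].
  rewrite -big_seq; apply: sum_integral_disjoint_le => // Q /S0P[/mS' mQ QP _].
  by split.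
pose g x := \prod_i v i x `^ (beta i / alpha).
have mg : measurable_fun [set: T] g.
  by apply: emeasurable_prod => i; exact: measurable_poweR_comp (nv i).1.
have g0 x : 0 <= g x by apply: prode_ge0 => i _; exact: poweR_ge0.
(* First embedding, with respect to [mu]: by sparseness [m] is a Carleson sequence, and [K] controls
   the maximal function of [density] over the cubes inside [P]. *)
have embed1 P : P \in S' ->
    (\sum_(Q <- S' | `[< Q `<=` P >]) m Q * density Q)%R%:E <=
    (2 * K)%:E * \int[mu]_(x in P) g x.
  move=> PS'; pose SP := [seq Q <- S' | `[< Q `<=` P >]].
  have SPS' : {subset SP <= S'} by move=> Q; rewrite mem_filter => /andP[].
  rewrite -big_filter -/SP.
  apply: le_trans (@carleson_embedding _ _ _ mu SP m density 2 (cst 1)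
    _ _ _ _ _ _ _ _) _ => //.
  - exact: laminar_sub SPS' lamS'.
  - by move=> Q /SPS' /mS'.
  - exact: density_ge0.
  - move=> P' /SPS' P'S'; rewrite integral_cst; last exact: mS'.
    rewrite mul1e muE// -EFinM lee_fin; apply: le_trans (sparse _ P'S').
    rewrite big_filter_cond [leLHS]big_mkcond [leRHS]big_mkcond/=.
    by apply: ler_sum => Q _; case: ifPn => [/andP[_ ->]//|_]; case: ifPn.
  rewrite EFinM -muleA; apply: lee_wpmul2l; first by rewrite lee_fin.
  under eq_integral do rewrite mule1; apply: hFW; first exact: S'S.
  by move=> Q; rewrite mem_filter => /andP[/asboolP QP /S'S].
pose E i := fine (energy i).
have EE i : energy i = (E i)%:E.
  by rewrite fineK// ge0_fin_numE ?energy_fin// integral_ge0// => x _; exact: (nft i).2.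
have E0 i : (0 <= E i)%R.
  by rewrite fine_ge0// integral_ge0// => x _; exact: (nft i).2.
pose avg i Q := (mass (fv i) Q / mass (v i) Q)%R.
have avg0 i Q : (0 <= avg i Q)%R by rewrite divr_ge0//; apply: mass_ge0.
pose H Q := (\prod_i (E i `^ (rho i * r i / alpha) *
                      avg i Q `^ (t i * beta i / alpha)))%R.
have H0 Q : (0 <= H Q)%R.
  by apply: prodr_ge0 => i _; rewrite mulr_ge0// powR_ge0.
(* The energies over the whole space serve as [B i], which makes the fractional factors independent
   of the cube. *)
have cube Q : Q \in S' ->
    (cube_value Q `^ alpha^-1 * mass w Q <=
     A `^ alpha^-1 * (m Q * density Q * H Q))%R.
  move=> QS'; have gQ := goodS (S'S _ QS'); have [mQ _ wQ vQ _] := gQ.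
  apply: strong_type_cube => //.
  - exact/mu_gt0/S'S.
  - exact: mass_gt0.
  - by move=> i; exact: mass_gt0.
  - by move=> i; exact: G0.
  - exact/muckS/S'S.
  - move=> i; have [/andP[ft0 _] _ _] := good_cube_power i gQ.
    rewrite -lte_fin -EE; apply: lt_le_trans ft0 _.
    by apply: ge0_subset_integral => //; [exact: (nft i).1|move=> x _; exact: (nft i).2].
  - move=> i; have [ftQ _ /le_trans] := good_cube_power i gQ; apply.
    have ft0 := mass_gt0 ftQ.
    have ftE : (mass (ftv i) Q <= E i)%R.
      rewrite -lee_fin -EE -massE//.
      by apply: ge0_subset_integral => //; [exact: (nft i).1|move=> x _; exact: (nft i).2].
    by rewrite lerD2r ler_ln// posrE// (lt_le_trans ft0).
have step1 : \int[mu]_x ((stepmax 0%R S cube_value x `^ alpha^-1)%:E * w x) <=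
    ((2 `^ gamma) `^ alpha^-1)%:E *
    \int[mu]_x ((stepmax 0%R S' cube_value x `^ alpha^-1)%:E * w x).
  have mstep S1 : (forall Q, Q \in S1 -> measurable Q) -> measurable_fun [set: T]
      (fun x => (stepmax 0%R S1 cube_value x `^ alpha^-1)%:E * w x).
    move=> mS1; apply: emeasurable_funM => //.
    exact: (measurable_stepmax (fun y => (y `^ alpha^-1)%:E)).
  have step0 S1 x : 0 <= (stepmax 0%R S1 cube_value x `^ alpha^-1)%:E * w x.
    by rewrite mule_ge0// lee_fin powR_ge0.
  rewrite -ge0_integralZl_EFin ?powR_ge0//; last exact: mstep.
  apply: ge0_le_integral => //; first exact: mstep.
    by apply: emeasurable_funM => //; exact: mstep.
  move=> x _; rewrite muleA -EFinM; apply: lee_wpmul2r => //.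
  have M0 : (0 <= stepmax 0 S' cube_value x)%R by exact: stepmax_ge_id.
  rewrite -powRM ?powR_ge0// lee_fin.
  apply: ge0_ler_powR; rewrite ?nnegrE ?mulr_ge0 ?powR_ge0 ?(ltW p0)//.
    exact: stepmax_ge_id.
  apply: stepmax_le => [|Q QS Qx]; first by rewrite mulr_ge0// powR_ge0.
  have [P [PS' QP /le_trans]] := domS' _ QS; apply.
  by rewrite ler_wpM2l ?powR_ge0// stepmax_ge//; exact: QP.
rewrite EFinM; apply: le_trans step1 _.
apply: lee_wpmul2l; first by rewrite lee_fin powR_ge0.
apply: le_trans (integral_stepmax_le_sum mu mw w0 p0 mS' cube_value_ge0) _.
rewrite big_seq (eq_bigr (fun Q => (cube_value Q `^ alpha^-1 * mass w Q)%:E)); last first.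
  by move=> Q /S'S /goodS[_ _ /massE -> _ _].
rewrite -big_seq sumEFin.
apply: (@le_trans _ _ (A `^ alpha^-1 * \sum_(Q <- S') m Q * density Q * H Q)%:E).
  by rewrite lee_fin mulr_sumr big_seq [leRHS]big_seq; exact: ler_sum.
rewrite !EFinM; apply: lee_wpmul2l; first by rewrite lee_fin powR_ge0.
(* Second embedding: by [embed1], [m Q * density Q] is a Carleson sequence for the geometric mean
   [g] of the weights. *)
apply: le_trans (@carleson_embedding _ _ _ mu S' (fun Q => m Q * density Q)%R H
  (2 * K)%R g _ _ _ _ _ _ _ _) _ => //.
- by move=> Q; rewrite mulr_ge0// density_ge0.
- by rewrite mulr_ge0.
rewrite EFinM; apply: lee_wpmul2l; first by rewrite lee_fin mulr_ge0.
pose M i x := stepmax 0%R S' (avg i) x.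
have M0 i x : (0 <= M i x)%R by exact: stepmax_ge_id.
have te0 i : (0 <= t i * beta i / alpha)%R.
  rewrite divr_ge0 ?(ltW alpha_gt0)// mulr_ge0 ?(ltW (beta_gt0 _ _ _))//.
  by rewrite ltW// (lt_trans _ (ht i)).
pose Z := (\prod_i E i `^ (rho i * r i / alpha))%R.
have Z0 : (0 <= Z)%R by apply: prodr_ge0 => i _; exact: powR_ge0.
have mM i : measurable_fun [set: T] (fun x => (M i x `^ t i)%:E * v i x).
  apply: emeasurable_funM; last exact: (nv i).1.
  exact: (measurable_stepmax (fun y => (y `^ t i)%:E)).
have Mv0 i x : 0 <= (M i x `^ t i)%:E * v i x.
  by rewrite mule_ge0 ?lee_fin ?powR_ge0//; exact: (nv i).2.
have mMp : measurable_fun [set: T]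
    (fun x => \prod_i ((M i x `^ t i)%:E * v i x) `^ (beta i / alpha)).
  by apply: emeasurable_prod => i; exact: measurable_poweR_comp.
have Mp0 x : 0 <= \prod_i ((M i x `^ t i)%:E * v i x) `^ (beta i / alpha).
  by apply: prode_ge0 => i _; exact: poweR_ge0.
(* The maximum of the products [H Q] is at most [Z] times the product of powers of the maxima [M i];
   the powers of the weights in [g] are distributed among these. *)
apply: (@le_trans _ _ (\int[mu]_x (Z%:E *
    \prod_i ((M i x `^ t i)%:E * v i x) `^ (beta i / alpha)))).
  apply: ge0_le_integral => //.
  - by move=> x _; rewrite mule_ge0// lee_fin stepmax_ge_id.
  - apply: emeasurable_funM => //.
    exact: (measurable_stepmax (fun y : R => y%:E)).
  - exact: emeasurable_funM.
  move=> x _; rewrite (eq_bigr (fun i => (M i x `^ (t i * beta i / alpha))%:E *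
      v i x `^ (beta i / alpha))); last first.
    move=> i _; rewrite poweRM ?lee_fin ?powR_ge0//; last exact: (nv i).2.
    by rewrite poweR_EFin -powRrM mulrA.
  rewrite big_split/= muleA prodEFin -EFinM; apply: lee_wpmul2r => //.
  rewrite lee_fin /Z -big_split/=; apply: stepmax_le => [|Q QS' Qx].
    by apply: prodr_ge0 => i _; rewrite mulr_ge0// powR_ge0.
  apply: ler_prod => i _; rewrite mulr_ge0 ?powR_ge0//=.
  apply: ler_wpM2l; first exact: powR_ge0.
  by apply: ge0_ler_powR; rewrite ?nnegrE//; exact: stepmax_ge.
rewrite ge0_integralZl_EFin//.
rewrite big_split/= EFinM; apply: lee_wpmul2l; first by rewrite lee_fin.
have be0 i : (0 < beta i / alpha)%R by rewrite divr_gt0// beta_gt0.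
have be1 : (\sum_i beta i / alpha = 1)%R by rewrite -mulr_suml divff ?gt_eqF.
(* Hoelder's inequality separates the indices, and Doob's inequality then bounds each factor by its
   energy. *)
apply: le_trans (hoelder_prod mu measurableT be0 be1 mM Mv0) _.
rewrite -prodEFin; apply: lee_prod => i; rewrite poweR_ge0/= -poweR_EFin.
apply: gt0_ler_poweR; rewrite ?in_itv/= ?andbT ?leey ?(ltW (be0 i))//.
- by rewrite integral_ge0.
- by rewrite andbT lee_fin mulr_ge0 ?powR_ge0//; exact: E0.
rewrite EFinM -/(E i) -EE; have [[mf f0] [mv v0]] := (nf i, nv i).
apply: doob_inequality => //.
- by move=> Q /S'S /goodS[_ _ _ /(_ i)/andP[]].
move=> Q QS'; have gQ := goodS (S'S _ QS'); have [_ _ _ vQ _] := gQ.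
have [_ fvQ _] := good_cube_power i gQ.
by rewrite (massE (vQ i)) (massE fvQ) -EFinM divfK// gt_eqF// mass_gt0.
Qed.

End family.
End finite_families_of_cubes.

(** * Passage from finite families to a countable grid *)

Lemma le_poweR {R : realType} (p : R) (x y : \bar R) : (0 <= p)%R -> 0 <= x ->
  x <= y -> x `^ p <= y `^ p.
Proof.
move=> p0 x0 xy; apply: gt0_ler_poweR => //; rewrite in_itv/= leey andbT//.
exact: le_trans xy.
Qed.

Section exhaustion.
Context {d : measure_display} {T : measurableType d} {R : realType}.
Variable mu : {measure set T -> \bar R}.
Implicit Types (D : set (set T)) (S : seq (set T)).

Lemma countable_exhaustion D : countable D -> exists e : nat -> seq (set T),
  [/\ forall N Q, Q \in e N -> D Q,
      {homo e : N M / (N <= M)%N >-> {subset N <= M}} &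
      forall Q, D Q -> exists N, Q \in e N].
Proof.
move=> /countable_injP[k kinj].
(* An index that is not attained gives [set0]; filtering by [D] keeps the lists inside [D]. *)
pose c j := xget set0 [set Q | D Q /\ k Q = j].
exists (fun N => [seq c j | j <- iota 0 N & `[< D (c j) >]]); split.
- by move=> N Q /mapP[j]; rewrite mem_filter => /andP[/asboolP ? _] ->.
- move=> N M NM Q /mapP[j]; rewrite mem_filter mem_iota => /and3P[Dj _ jN] ->.
  by apply: map_f; rewrite mem_filter Dj mem_iota (leq_trans jN).
move=> Q DQ; have cQ : c (k Q) = Q.
  rewrite /c; case: xgetP => [P _ [DP kP]|/(_ Q)[]//].
  by apply: kinj; rewrite ?in_setE.
exists (k Q).+1; apply/mapP; exists (k Q); rewrite ?cQ// mem_filter cQ.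
by rewrite mem_iota add0n leqnn !andbT; exact/asboolP.
Qed.

Section maximal.
Variables (k : nat) (r rho : 'I_k -> R) (g : 'I_k -> T -> \bar R).

Definition extended_cube_value (Q : set T) : \bar R :=
  \prod_(i < k) (mu Q `^ (- (1 - rho i))%R * \int[mu]_(y in Q) g i y) `^ r i.

Variables (D : set (set T)) (e : nat -> seq (set T)).
Hypotheses (eD : forall N Q, Q \in e N -> D Q)
  (e_homo : {homo e : N M / (N <= M)%N >-> {subset N <= M}})
  (De : forall Q, D Q -> exists N, Q \in e N)
  (mD : forall Q, D Q -> measurable Q).

Lemma maximal_ge0 x : 0 <= maximal mu D r rho g x.
Proof. exact: (ereal_sup_ubound (or_introl erefl)). Qed.

Lemma le_maximal Q x : D Q -> Q x -> extended_cube_value Q <= maximal mu D r rho g x.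
Proof. by move=> DQ Qx; apply: ereal_sup_ubound; right; exists Q; split. Qed.

Lemma stepmax_le_maximal S x : (forall Q, Q \in S -> D Q) ->
  stepmax 0 S extended_cube_value x <= maximal mu D r rho g x.
Proof.
move=> SD; apply: stepmax_le; first exact: maximal_ge0.
by move=> Q /SD; exact: le_maximal.
Qed.

Lemma maximalE x : maximal mu D r rho g x =
  ereal_sup (range (fun N => stepmax 0 (e N) extended_cube_value x)).
Proof.
apply/le_anti/andP; split; apply: ge_ereal_sup => y.
  move=> [->|[Q [DQ Qx] <-]].
    apply: (@le_trans _ _ (stepmax 0 (e 0%N) extended_cube_value x)).
      exact: stepmax_ge_id.
    by apply: ereal_sup_ubound; exists 0%N.
  have [N QN] := De DQ.
  apply: (@le_trans _ _ (stepmax 0 (e N) extended_cube_value x)).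
    exact: (stepmax_ge _ extended_cube_value).
  by apply: ereal_sup_ubound; exists N.
by move=> [N _ <-]; apply: stepmax_le_maximal; exact: eD.
Qed.

Lemma measurable_maximal : measurable_fun [set: T] (maximal mu D r rho g).
Proof.
have meas N : measurable_fun [set: T] (stepmax 0 (e N) extended_cube_value).
  exact: (measurable_stepmax (fun y : \bar R => y) _ _ (fun Q QN => mD (eD QN))).
have := measurable_fun_esups meas 0%N; congr measurable_fun.
apply/funext => x; rewrite maximalE /esups/= /sdrop; congr ereal_sup.
by apply/seteqP; split=> y [N _ <-]; exists N.
Qed.

(** Monotone convergence along the exhaustion. [phi] will be the power [1 / alpha] or the indicator
    of the values above a level; the assumption on suprema is the semicontinuity that lets it pass
    to the limit. *)
Lemma integral_maximal_le (phi : \bar R -> \bar R) (w : T -> \bar R) (B : \bar R) :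
  nonneg_measurable w -> (forall y, 0 <= phi y) ->
  (forall y z, 0 <= y -> y <= z -> phi y <= phi z) ->
  (forall (u : nat -> \bar R) z, (forall N, 0 <= u N) ->
     (forall N, phi (u N) <= z) -> phi (ereal_sup (range u)) <= z) ->
  (forall S, (forall Q, Q \in S -> D Q) ->
    \int[mu]_x (phi (stepmax 0 S extended_cube_value x) * w x) <= B) ->
  \int[mu]_x (phi (maximal mu D r rho g x) * w x) <= B.
Proof.
move=> [mw w0] phi0 phi_le phi_sup SB.
pose u N x := stepmax 0 (e N) extended_cube_value x.
pose F N x := phi (u N x) * w x.
have u0 N x : 0 <= u N x by exact: stepmax_ge_id.
have mF N : measurable_fun [set: T] (F N).
  apply: emeasurable_funM => //; apply: (measurable_stepmax phi) => Q /eD /mD//.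
have F0 N x : 0 <= F N x by rewrite mule_ge0.
have F_homo x : {homo F^~ x : N M / (N <= M)%N >-> N <= M}.
  move=> N M NM; apply: lee_wpmul2r => //; apply: phi_le => //.
  apply: stepmax_le; first exact: stepmax_ge_id.
  by move=> Q QN Qx; apply: (stepmax_ge _ extended_cube_value) => //; exact: e_homo QN.
have -> : \int[mu]_x (phi (maximal mu D r rho g x) * w x) =
    \int[mu]_x limn (F^~ x).
  apply: eq_integral => x _.
  have -> : limn (F^~ x) = ereal_sup (range (F^~ x)).
    by apply/cvg_lim => //; apply: ereal_nondecreasing_cvgn; exact: F_homo.
  rewrite maximalE; apply/le_anti/andP; split; last first.
    apply: ge_ereal_sup => _ [N _ <-]; apply: lee_wpmul2r => //; apply: phi_le => //.
    by apply: ereal_sup_ubound; exists N.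
  set z := ereal_sup (range (F^~ x)).
  have Fz N : F N x <= z by apply: ereal_sup_ubound; exists N.
  have z0 : 0 <= z by apply: le_trans (F0 0%N x) (Fz _).
  move: Fz; rewrite /F; have := w0 x; case: (w x) => [y| |//].
    rewrite lee_fin => y_ge0 Fz.
    have [->|y_neq0] := eqVneq y 0%R; first by rewrite mule0.
    have y0 : (0 < y)%R by rewrite lt0r y_neq0.
    rewrite -lee_pdivlMr//; apply: phi_sup => N; first exact: u0.
    by rewrite lee_pdivlMr//; exact: Fz.
  (* Where the weight is infinite, a finite limit forces [phi] to vanish on all the step maxima,
     hence on their supremum. *)
  move=> _ Fz; have [zy|zfin] := eqVneq z +oo; first by rewrite zy leey.
  rewrite (_ : phi _ = 0) ?mul0e//; apply/le_anti; rewrite phi0 andbT.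
  apply: phi_sup => N; first exact: u0.
  rewrite leNgt; apply/negP => phiN.
  by move: (Fz N); rewrite gt0_muley// leye_eq (negPf zfin).
rewrite monotone_convergence//; apply: lime_le.
  apply: ereal_nondecreasing_is_cvgn => N M NM.
  by apply: ge0_le_integral => // x _; exact: F_homo.
by apply: nearW => N; apply: SB => Q; exact: eD.
Qed.

(** A discarded cube has value 0, the base of the step maximum, or lies in the union of the cubes of
    zero [w]-mass, where [w] vanishes almost everywhere. *)
Lemma integral_stepmax_discard (phi : \bar R -> \bar R) (w : T -> \bar R) S
    (good : pred (set T)) : nonneg_measurable w -> (forall y, 0 <= phi y) ->
  (forall y z, 0 <= y -> y <= z -> phi y <= phi z) ->
  (forall Q, Q \in S -> D Q) ->
  (forall Q, Q \in S -> ~~ good Q -> extended_cube_value Q = 0 \/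
                                     \int[mu]_(x in Q) w x = 0) ->
  \int[mu]_x (phi (stepmax 0 S extended_cube_value x) * w x) <=
  \int[mu]_x (phi (stepmax 0 [seq Q <- S | good Q] extended_cube_value x) * w x).
Proof.
move=> [mw w0] phi0 phi_le SD bad.
pose null := [seq Q <- S | `[< \int[mu]_(x in Q) w x = 0 >]].
have mS Q : Q \in S -> measurable Q by move=> /SD /mD.
have mnull : measurable (union_of null).
  by apply: measurable_union_of => Q; rewrite mem_filter => /andP[_ /mS].
have mphi S1 : {subset S1 <= S} -> measurable_fun [set: T]
    (fun x => phi (stepmax 0 S1 extended_cube_value x) * w x).
  move=> S1S; apply: emeasurable_funM => //.
  by apply: (measurable_stepmax phi) => Q /S1S /mS.
have w_null : \int[mu]_(x in union_of null) w x = 0.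
  apply/le_anti; rewrite integral_ge0// andbT.
  apply: le_trans (integral_cover_le mu mw w0 mnull _ (fun x => id)) _.
    by move=> Q; rewrite mem_filter => /andP[_ /mS].
  rewrite big_seq big1// => Q; rewrite mem_filter => /andP[/asboolP]//.
apply: ae_ge0_le_integral => //.
- by move=> x _; rewrite mule_ge0.
- exact: mphi.
- by move=> x _; rewrite mule_ge0.
- by apply: mphi => Q; rewrite mem_filter => /andP[].
have : ae_eq mu (union_of null) w (cst 0).
  apply/ae_eq_integral_abs => //; first exact: measurable_funTS.
  by rewrite -[RHS]w_null; apply: eq_integral => x _; rewrite gee0_abs.
apply: filterS => x wx _; have [Nx|Nx] := pselect (union_of null x).
  by rewrite wx// !mule0.
apply: lee_wpmul2r => //; apply: phi_le; first exact: stepmax_ge_id.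
apply: stepmax_le; first exact: stepmax_ge_id.
move=> Q QS Qx; have [gQ|] := boolP (good Q).
  by apply: (stepmax_ge _ extended_cube_value) => //; rewrite mem_filter gQ.
move=> /(bad _ QS)[->|wQ]; first exact: stepmax_ge_id.
exfalso; apply: Nx; exists Q => //; rewrite mem_filter QS andbT.
exact/asboolP.
Qed.

End maximal.
End exhaustion.

(** * Splitting off the last index, inverse powers and bookkeeping of constants *)

Lemma big_ord_lift V (idx : V) (op : Monoid.law idx) n (F : 'I_n.+1 -> V) :
  \big[op/idx]_i F i = op (\big[op/idx]_i F (lift ord_max i)) (F ord_max).
Proof.
rewrite big_ord_recr/=; congr (op _ _); apply: eq_bigr => i _.
by congr F; apply/ord_inj; rewrite lift_max.
Qed.

Lemma append_last_lift {R : realType} n (x : 'I_n -> R) a i :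
  append_last x a (lift ord_max i) = x i.
Proof. by rewrite /append_last liftK. Qed.

Lemma append_last_max {R : realType} n (x : 'I_n -> R) a :
  append_last x a ord_max = a.
Proof. by rewrite /append_last unlift_none. Qed.

Lemma poweRK {R : realType} (p : R) (x : \bar R) : p != 0%R -> 0 <= x ->
  (x `^ p) `^ p^-1 = x.
Proof. by move=> p0 x0; rewrite -poweRrM divff// poweRe1. Qed.

Lemma poweRVK {R : realType} (p : R) (x : \bar R) : p != 0%R -> 0 <= x ->
  (x `^ p^-1) `^ p = x.
Proof. by move=> p0 x0; rewrite -poweRrM mulVf// poweRe1. Qed.

Lemma stepmax_EFin {d} {T : measurableType d} {R : realType}
    (S : seq (set T)) (H : set T -> \bar R) (h : set T -> R) x :
  (forall Q, Q \in S -> H Q = (h Q)%:E) ->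
  stepmax 0 S H x = (stepmax 0%R S h x)%:E.
Proof.
move=> Hh; apply/le_anti/andP; split.
  apply: stepmax_le => [|Q QS Qx]; first by rewrite lee_fin stepmax_ge_id.
  by rewrite Hh// lee_fin stepmax_ge.
have M0 : 0 <= stepmax 0 S H x by exact: stepmax_ge_id.
have [->|My] := eqVneq (stepmax 0 S H x) +oo; first by rewrite leey.
have Mfin : stepmax 0 S H x \is a fin_num by rewrite ge0_fin_numE// ltey.
rewrite -(fineK Mfin) lee_fin; apply: stepmax_le => [|Q QS Qx]; first exact: fine_ge0.
by rewrite -lee_fin fineK// -Hh//; exact: stepmax_ge.
Qed.

Lemma powR_regroup {R : realType} (rho r t a c e : R) :
  (0 <= c)%R -> (0 < e)%R ->
  (e `^ (rho * r / a) * (c * e) `^ (r * (t^-1 - rho) / a) =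
   (c `^ (r * (t^-1 - rho))) `^ a^-1 * (e `^ (r / t)) `^ a^-1)%R.
Proof.
move=> c0 e0; rewrite powRM// ?(ltW e0)// mulrCA -!powRrM; congr (_ * _)%R.
rewrite -powRD; last by rewrite (gt_eqF e0) implybT.
by congr powR; ring.
Qed.

(** Everything is brought under the power [1 / a], to be removed later by raising to the power [a].
    The sparseness constant 2 becomes [(2 ^ a) ^ (1 / a)], and the energies combine because
    [rho + (1 / t - rho) = 1 / t]. *)
Lemma strong_constant_regroup {R : realType} n (rho r t c e : 'I_n -> R)
    (g a x y : R) : (0 < a)%R -> (0 <= x)%R -> (0 <= y)%R ->
  (forall i, 0 <= c i)%R -> (forall i, 0 < e i)%R ->
  ((2 `^ g) `^ a^-1 * (x `^ a^-1 * (2 * y `^ a^-1 *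
    \prod_i (e i `^ (rho i * r i / a) *
             (c i * e i) `^ (r i * ((t i)^-1 - rho i) / a)))) =
   (2 `^ g * 2 `^ a * \prod_i c i `^ (r i * ((t i)^-1 - rho i)) *
     (x * y * \prod_i e i `^ (r i / t i))) `^ a^-1)%R.
Proof.
move=> a0 x0 y0 c0 e0.
rewrite (eq_bigr _ (fun i _ => powR_regroup (rho i) (r i) (t i) a (c0 i) (e0 i))).
have C0 : (0 <= \prod_i c i `^ (r i * ((t i)^-1 - rho i)))%R.
  by apply: prodr_ge0 => i _; exact: powR_ge0.
have E0 : (0 <= \prod_i e i `^ (r i / t i))%R.
  by apply: prodr_ge0 => i _; exact: powR_ge0.
rewrite big_split/=.
rewrite -(powR_prod a^-1 (fun i => powR_ge0 (c i) (r i * ((t i)^-1 - rho i)))).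
rewrite -(powR_prod a^-1 (fun i => powR_ge0 (e i) (r i / t i))).
move: (\prod_i _)%R (\prod_i _)%R C0 E0 => C E C0 E0.
rewrite (powRM _ (mulr_ge0 (mulr_ge0 (powR_ge0 _ _) (powR_ge0 _ _)) C0)
  (mulr_ge0 (mulr_ge0 x0 y0) E0)).
rewrite (powRM _ (mulr_ge0 (powR_ge0 _ _) (powR_ge0 _ _)) C0).
rewrite (powRM _ (powR_ge0 _ _) (powR_ge0 _ _)) (powRM _ (mulr_ge0 x0 y0) E0).
rewrite (powRM _ x0 y0) -[((2 `^ a) `^ _)%R]powRrM divff ?gt_eqF// powRr1//.
ring.
Qed.

(** * Both estimates for the maximal operator of a dyadic grid *)

Section main_estimates.
Context {R : realType} {n : nat}.
Variables r rho t : 'I_n -> R.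
Hypotheses (hr : forall i, (0 < r i)%R) (ht : forall i, (1 < t i)%R)
  (hrho0 : forall i, (0 <= rho i)%R)
  (htrho : forall i, (rho i < (t i)^-1)%R).

Local Notation beta := (fun i => r i * ((t i)^-1 - rho i))%R.
Local Notation alpha := (\sum_i beta i)%R.
Local Notation gamma := (\sum_i r i * (1 - rho i))%R.
Local Notation q := (append_last (fun i => r i / conj_exponent (t i))%R alpha).
Hypothesis alpha_gt0 : (0 < alpha)%R.

Context {d : measure_display} {T : measurableType d}.
Variables (mu : {measure set T -> \bar R}) (D : set (set T)).
Variables (w : 'I_n.+1 -> T -> \bar R) (f : 'I_n -> T -> \bar R).
Hypotheses (gridD : dyadic_grid mu D) (nw : forall i, nonneg_measurable (w i))
  (nf : forall i, nonneg_measurable (f i)).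

Local Notation v := (fun i => w (lift ord_max i)).
Local Notation u := (w ord_max).
Local Notation A := (muckenhoupt mu D q w).
Local Notation F := (\prod_i weighted_norm mu (t i) (v i) (f i) `^ r i).
Local Notation FW := (fujii_wilson mu D (append_last beta 0%R) w).
Local Notation fv := (fun i x => f i x * v i x).
Local Notation E := (energy t mu f v).
Local Notation cube := (extended_cube_value mu r rho fv).
Local Notation good := (good_cube mu f v u).

Let t_gt0 i : (0 < t i)%R. Proof. exact: lt_trans (ht i). Qed.

Let D_mu Q : D Q -> [/\ measurable Q, (0 < fine (mu Q))%R & mu Q = (fine (mu Q))%:E].
Proof.
case: gridD => _ /(_ Q) + _ DQ => /(_ DQ)[mQ Q0 Qy]; split => //.
  by rewrite fine_gt0// Q0.
by rewrite fineK// ge0_fin_numE.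
Qed.

Let mD Q : D Q -> measurable Q. Proof. by move=> /D_mu[]. Qed.

Let conjE i : (r i / conj_exponent (t i) = r i * (1 - (t i)^-1))%R.
Proof.
rewrite /conj_exponent; field.
by rewrite gt_eqF//= gt_eqF// subr_gt0.
Qed.

Let q_gt0 i : (0 < q i)%R.
Proof.
case: (unliftP ord_max i) => [j ->|->]; last by rewrite append_last_max.
by rewrite append_last_lift conjE mulr_gt0// subr_gt0 invf_lt1.
Qed.

Let A0 : 0 <= A. Proof. exact: (ereal_sup_ubound (or_introl erefl)). Qed.

Let F0 : 0 <= F. Proof. by apply: prode_ge0 => i _; exact: poweR_ge0. Qed.

Let averageE Q i : D Q -> average mu Q (w i) =
  ((fine (mu Q))^-1)%:E * \int[mu]_(x in Q) w i x.
Proof. by move=> /D_mu[_ m0 mE]; rewrite /average {1}mE inver gt_eqF. Qed.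

Let muckenhoupt_ge Q : D Q -> \prod_i average mu Q (w i) `^ q i <= A.
Proof. by move=> DQ; apply: ereal_sup_ubound; right; exists Q. Qed.

Let FE : F = \prod_i E i `^ (r i / t i).
Proof. by apply: eq_bigr => i _; rewrite -poweRrM mulrC. Qed.

Let energy_ge0 i : 0 <= E i.
Proof.
by apply: integral_ge0 => x _; rewrite mule_ge0 ?poweR_ge0//; exact: (nw _).2.
Qed.

Lemma energy_gt0 i Q : measurable Q ->
  0 < \int[mu]_(x in Q) (f i x * v i x) -> 0 < E i.
Proof.
move=> mQ fvQ; have [mf f0] := nf i; have [mv v0] := nw (lift ord_max i).
have ft0 x : 0 <= f i x `^ t i * v i x by rewrite mule_ge0// poweR_ge0.
apply: (@lt_le_trans _ _ (\int[mu]_(x in Q) (f i x `^ t i * v i x))); last first.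
  apply: ge0_subset_integral => //.
  by apply: emeasurable_funM => //; exact: measurable_poweR_comp.
rewrite lt0e integral_ge0// andbT; apply/negP => /eqP ftv0.
have := hoelder_power mu (ht i) mQ mf f0 mv v0.
rewrite ftv0 poweR0r ?mul0e ?leNgt ?fvQ//.
by rewrite gt_eqF// invr_gt0.
Qed.

(** If neither alternative holds, Hoelder's inequality makes the [v i]-masses and the energies
    positive. Then [F > 0], so [A] is finite, and the averages of the weights on [Q], being positive
    with a finite product of powers, are finite: the cube is good. *)
Lemma good_or_null Q : D Q -> A * F < +oo -> ~ good Q ->
  cube Q = 0 \/ \int[mu]_(x in Q) u x = 0.
Proof.
move=> DQ AF ngood.
have int_ge0 (g : T -> \bar R) : nonneg_measurable g -> 0 <= \int[mu]_(x in Q) g x.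
  by move=> [_ g0]; exact: integral_ge0.
have [mQ m0 mE] := D_mu DQ.
have [?|uQ] := eqVneq (\int[mu]_(x in Q) u x) 0; [by right|left].
have [/existsP[j /eqP fvj]|/existsPn fvQ] :=
    boolP [exists j, \int[mu]_(x in Q) (f j x * v j x) == 0].
  rewrite /extended_cube_value (bigD1 j)//= fvj mule0 poweR0r ?mul0e//.
  by rewrite gt_eqF.
exfalso; apply: ngood.
have {}uQ : 0 < \int[mu]_(x in Q) u x by rewrite lt0e uQ int_ge0.
have {}fvQ i : 0 < \int[mu]_(x in Q) (f i x * v i x).
  rewrite lt0e fvQ integral_ge0// => x _.
  by rewrite mule_ge0//; [exact: (nf i).2|exact: (nw _).2].
have hoe i := hoelder_power mu (ht i) mQ (nf i).1 (nf i).2 (nw (lift ord_max i)).1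
                (nw (lift ord_max i)).2.
have vQ i : 0 < \int[mu]_(x in Q) v i x.
  rewrite lt0e int_ge0// andbT; apply/negP => /eqP v0.
  have := hoe i; rewrite v0 poweR0r ?mule0 ?leNgt ?fvQ//.
  by rewrite subr_eq0 eq_sym lt_eqF// invf_lt1.
have E_gt0 i : 0 < E i by exact: energy_gt0 (fvQ i).
have F_gt0 : 0 < F by rewrite FE; apply: prode_gt0 => i; exact: poweR_gt0.
have Afin : A < +oo.
  by rewrite ltey; apply: contraTneq AF => ->; rewrite gt0_mulye.
have wQ i : 0 < \int[mu]_(x in Q) w i x.
  by case: (unliftP ord_max i) => [j ->|->].
have avg_gt0 i : 0 < average mu Q (w i) `^ q i.
  by rewrite poweR_gt0// averageE// mule_gt0// lte_fin invr_gt0.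
have wQfin i : \int[mu]_(x in Q) w i x < +oo.
  rewrite ltey; apply: contraTneq Afin => wy.
  rewrite -leNgt; apply: le_trans (muckenhoupt_ge DQ).
  rewrite (@prode_eqy _ _ _ i)// averageE// wy gt0_muley ?lte_fin ?invr_gt0//.
  by rewrite poweRyr// gt_eqF.
split => //.
- by rewrite mE lte_fin m0 ltry.
- by rewrite uQ wQfin.
- by move=> i; rewrite vQ wQfin.
Qed.

Lemma good_gt0 Q : D Q -> good Q -> [/\ 0 < A, 0 < F & forall i, 0 < E i].
Proof.
move=> DQ [mQ muQ uQ vQ fvQ]; have [_ m0 _] := D_mu DQ.
have E_gt0 i : 0 < E i by exact: energy_gt0 (fvQ i).
split => //; last by rewrite FE; apply: prode_gt0 => i; exact: poweR_gt0.
apply: lt_le_trans (muckenhoupt_ge DQ); apply: prode_gt0 => i.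
rewrite poweR_gt0// averageE// mule_gt0//; first by rewrite lte_fin invr_gt0.
by case: (unliftP ord_max i) => [j ->|->]; [case/andP: (vQ j)|case/andP: uQ].
Qed.

(** All factors are positive, so finiteness of the product passes to [A], to [F] and to each
    energy. *)
Lemma good_finite Q : D Q -> good Q -> A * F < +oo ->
  [/\ A \is a fin_num, F \is a fin_num, (forall i, E i < +oo),
      (forall i, (0 < fine (E i))%R) &
      F = (\prod_i fine (E i) `^ (r i / t i))%:E].
Proof.
move=> DQ gQ AF; have [A_gt0 F_gt0 E_gt0] := good_gt0 DQ gQ.
have Ep_gt0 i : 0 < E i `^ (r i / t i) by exact: poweR_gt0.
have Afin : A < +oo.
  by rewrite ltey; apply: contraTneq AF => ->; rewrite gt0_mulye.
have Ffin : F < +oo.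
  by rewrite ltey; apply: contraTneq AF => ->; rewrite gt0_muley.
have Efin i : E i < +oo.
  rewrite ltey; apply: contraTneq Ffin => Ey.
  rewrite -leNgt FE (@prode_eqy _ _ _ i)// Ey poweRyr// gt_eqF// divr_gt0//.
split => //.
- by rewrite ge0_fin_numE.
- by rewrite ge0_fin_numE.
- by move=> i; rewrite fine_gt0// E_gt0 Efin.
rewrite FE -prodEFin; apply: eq_bigr => i _.
by rewrite -poweR_EFin fineK// ge0_fin_numE.
Qed.

Lemma muckenhoupt_cube_le Q : D Q -> good Q -> A \is a fin_num ->
  (muckenhoupt_cube r rho t mu v u Q <= fine A)%R.
Proof.
move=> DQ [mQ muQ uQ vQ fvQ] Afin; rewrite -lee_fin fineK//.
apply: le_trans (muckenhoupt_ge DQ); rewrite big_ord_lift /=.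
rewrite append_last_max averageE// (massE uQ) -EFinM poweR_EFin.
rewrite (eq_bigr (fun i => ((mass mu (v i) Q / fine (mu Q)) `^
    (r i * (1 - (t i)^-1)))%:E)); last first.
  move=> i _; rewrite append_last_lift conjE averageE// (massE (vQ i)) -EFinM.
  by rewrite poweR_EFin mulrC.
rewrite prodEFin -EFinM lee_fin /muckenhoupt_cube.
by rewrite [in leRHS]mulrC [in leRHS](mulrC _^-1)%R mulrC.
Qed.

Lemma extended_cube_valueE Q : good Q -> (forall i, E i < +oo) ->
  cube Q = (cube_value r rho mu f v Q)%:E.
Proof.
move=> gQ Efin; rewrite -prodEFin; apply: eq_bigr => i _.
have [_ fvQ _] := good_cube_power ht nf (fun i => nw (lift ord_max i)) Efin i gQ.
have [_ muQ _ _ _] := gQ; have /andP[mu0 muy] := muQ.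
by rewrite (massE fvQ) -[mu Q in LHS]fineK ?ge0_fin_numE ?(ltW mu0).
Qed.

Local Notation beta0 := (append_last beta 0%R).

Let sum_beta0 : (\sum_i beta0 i = alpha)%R.
Proof.
rewrite big_ord_lift /= append_last_max addr0.
by apply: eq_bigr => i _; rewrite append_last_lift.
Qed.

Let bexp_gt0 i : (0 < beta i / alpha)%R.
Proof. by rewrite divr_gt0// beta_gt0. Qed.

Let bexp_sum : (\sum_i beta i / alpha = 1)%R.
Proof. by rewrite -mulr_suml divff// gt_eqF. Qed.

(** The maximal function inside the Fujii-Wilson characteristic. The last exponent is 0, so the
    weight [w ord_max] drops out. *)
Definition local_maximal (P : set T) : T -> \bar R :=
  maximal mu D (fun i => beta0 i / alpha)%R (fun=> 0%R)
    (fun i y => (\1_P y)%:E * w i y).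

Definition geometric_weight (x : T) : \bar R :=
  \prod_(i < n) v i x `^ (beta i / alpha).

Lemma fujii_wilson_ge P : D P ->
  quotient ((\int[mu]_(x in P) local_maximal P x) `^ alpha)
    ((\int[mu]_(x in P) geometric_weight x) `^ alpha) <= FW.
Proof.
move=> DP; apply: ereal_sup_ubound; right; exists P => //.
rewrite sum_beta0; congr (quotient _ (_ `^ _)).
apply: eq_integral => x _; rewrite big_ord_lift /= append_last_max mul0r poweRe0 mule1.
by apply: eq_bigr => i _; rewrite append_last_lift.
Qed.

Lemma le_local_maximal P Q x : D Q -> Q `<=` P -> Q x ->
  \prod_(i < n) average mu Q (v i) `^ (beta i / alpha) <= local_maximal P x.
Proof.
move=> DQ QP Qx; apply: le_trans (le_maximal _ _ _ _ DQ Qx).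
rewrite /extended_cube_value big_ord_lift /= append_last_max mul0r poweRe0 mule1.
rewrite le_eqVlt; apply/orP; left; apply/eqP; apply: eq_bigr => i _.
rewrite append_last_lift averageE//; have [_ m0 mE] := D_mu DQ.
congr (_ `^ _); rewrite subr0 {2}mE poweR_EFin powR_inv1 ?(ltW m0)//.
congr (_ * _); apply: eq_integral => y /set_mem Qy.
by rewrite indicE mem_set ?mul1e//; exact: QP.
Qed.

Let measurable_local P : measurable P -> measurable_fun [set: T] (local_maximal P).
Proof.
move=> mP; case: gridD => /countable_exhaustion[e [eD e_homo De]] _ _.
exact: measurable_maximal eD De mD.
Qed.

Let local_ge0 P x : 0 <= local_maximal P x.
Proof. exact: maximal_ge0. Qed.

Let measurable_geom : measurable_fun [set: T] geometric_weight.
Proof. by apply: emeasurable_prod => i; exact: measurable_poweR_comp (nw _).1. Qed.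

Let geom_ge0 x : 0 <= geometric_weight x.
Proof. by apply: prode_ge0 => i _; exact: poweR_ge0. Qed.

Lemma geometric_weight_le_prod P : D P ->
  \int[mu]_(x in P) geometric_weight x <=
  \prod_(i < n) (\int[mu]_(x in P) v i x) `^ (beta i / alpha).
Proof.
move=> DP; apply: hoelder_prod => //; first exact: mD.
- by move=> i; exact: (nw _).1.
- by move=> i; exact: (nw _).2.
Qed.

(** By Hoelder's inequality the left-hand side is at most [mu P] times the geometric mean of the
    averages over [P], and [P] itself is one of the cubes in the supremum at each of its points. *)
Lemma geometric_weight_le_local P : D P ->
  \int[mu]_(x in P) geometric_weight x <= \int[mu]_(x in P) local_maximal P x.
Proof.
move=> DP; apply: le_trans (geometric_weight_le_prod DP) _.
have [mP m0 mE] := D_mu DP; have int0 i : 0 <= \int[mu]_(x in P) v i x.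
  by apply: integral_ge0 => x _; exact: (nw _).2.
pose c := \prod_(i < n) average mu P (v i) `^ (beta i / alpha).
have c0 : 0 <= c by apply: prode_ge0 => i _; exact: poweR_ge0.
have -> : \prod_(i < n) (\int[mu]_(x in P) v i x) `^ (beta i / alpha) = c * mu P.
  rewrite /c [in RHS](eq_bigr (fun i => ((fine (mu P))^-1 `^ (beta i / alpha))%:E *
      (\int[mu]_(x in P) v i x) `^ (beta i / alpha))); last first.
    by move=> i _; rewrite /= averageE// poweRM ?lee_fin ?invr_ge0 ?(ltW m0)// poweR_EFin.
  rewrite big_split/= prodEFin prod_powR_expR; last by move=> i; rewrite invr_gt0.
  rewrite -mulr_suml bexp_sum mul1r lnK ?posrE ?invr_gt0//.
  by rewrite muleAC {2}mE -EFinM mulVf ?gt_eqF// mul1e.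
have -> : c * mu P = \int[mu]_(x in P) cst c x by rewrite integral_cst.
apply: ge0_le_integral => //; first exact/measurable_funTS/measurable_local.
by move=> x Px; exact: le_local_maximal.
Qed.

(** The numerator dominates the denominator by [geometric_weight_le_local], and the conventions of
    [quotient] settle the degenerate forms. Positivity of the characteristic later makes the
    right-hand side infinite when [A * F] is. *)
Lemma fujii_wilson_ge1 P : D P -> 1 <= FW.
Proof.
move=> DP; apply: le_trans (fujii_wilson_ge DP).
have a0 := ltW alpha_gt0.
have g0 : 0 <= \int[mu]_(x in P) geometric_weight x by exact: integral_ge0.
have : (\int[mu]_(x in P) geometric_weight x) `^ alpha <=
       (\int[mu]_(x in P) local_maximal P x) `^ alpha.
  by apply: le_poweR => //; exact: geometric_weight_le_local.
have : 0 <= (\int[mu]_(x in P) geometric_weight x) `^ alpha by exact: poweR_ge0.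
move: (_ `^ _) (_ `^ _) => a b; rewrite /quotient; case: eqP => // ab b0 ba.
have {}ba : b < a by rewrite lt_neqAle ba andbT; apply/eqP => ba'; apply: ab.
move: b b0 ba {ab} => [b|_|]//; last by rewrite ltNge leey.
rewrite lee_fin => b_ge0 ba; have a_gt0 : 0 < a by apply: le_lt_trans ba; rewrite lee_fin.
have [->|b_neq0] := eqVneq b 0%R; first by rewrite inve0 gt0_muley// leey.
by rewrite inver (negPf b_neq0) lee_pdivlMr ?mul1e ?(ltW ba)// lt0r b_neq0.
Qed.

(** The quotient is undone by cases: for equal terms the bound follows from [1 <= FW], and a zero
    denominator under a positive numerator would make [FW] infinite. *)
Lemma local_maximal_le P : D P -> FW < +oo ->
  \int[mu]_(x in P) geometric_weight x < +oo ->
  \int[mu]_(x in P) local_maximal P x <=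
  FW `^ alpha^-1 * \int[mu]_(x in P) geometric_weight x.
Proof.
move=> DP FWfin gfin; have FW1 := fujii_wilson_ge1 DP.
have FW0 : 0 <= FW by apply: le_trans FW1.
have a_neq0 : (alpha != 0)%R by rewrite gt_eqF.
have g0 : 0 <= \int[mu]_(x in P) geometric_weight x by exact: integral_ge0.
have l0 : 0 <= \int[mu]_(x in P) local_maximal P x by exact: integral_ge0.
rewrite -[leLHS](poweRK a_neq0)// -[X in _ <= _ * X](poweRK a_neq0)//.
rewrite -poweRM ?poweR_ge0//.
apply: le_poweR; rewrite ?poweR_ge0 ?invr_ge0 ?(ltW alpha_gt0)//.
have := fujii_wilson_ge DP; have := poweR_lty alpha gfin.
have := poweR_ge0 (\int[mu]_(x in P) geometric_weight x) alpha.
have := poweR_ge0 (\int[mu]_(x in P) local_maximal P x) alpha.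
move: ((\int[mu]_(x in P) local_maximal P x) `^ alpha)
  ((\int[mu]_(x in P) geometric_weight x) `^ alpha) => a [b| |]//.
rewrite /quotient; case: eqP => [-> _ b0 _ _|ab a0 b0 _].
  by rewrite -[leLHS]mul1e; apply: lee_wpmul2r.
have [b00|b_neq0] := eqVneq b 0%R.
  have a_gt0 : 0 < a.
    by rewrite lt0e a0 andbT; apply/eqP => a00; apply: ab; rewrite a00 b00.
  by rewrite b00 inve0 gt0_muley// leye_eq => /eqP FWy; rewrite FWy ltxx in FWfin.
by rewrite inver (negPf b_neq0) lee_pdivrMr// lt0r b_neq0 -lee_fin.
Qed.

(** The constants of [strong_type_family] raised to the power [alpha]: principal cubes, sparseness
    and Doob's inequality, in this order. *)
Definition strong_constant : R :=
  (2 `^ gamma * 2 `^ alpha *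
   \prod_i ((2 * (t i / (t i - 1))) `^ t i) `^ beta i)%R.

Lemma strong_constant_ge0 : (0 <= strong_constant)%R.
Proof.
rewrite /strong_constant !mulr_ge0 ?powR_ge0//.
by apply: prodr_ge0 => i _; exact: powR_ge0.
Qed.

Let laminarD S : (forall Q, Q \in S -> D Q) -> laminar S.
Proof. by case: gridD => _ _ lam SD Q Q' QS Q'S; apply: lam; exact: SD. Qed.

Section good_family.
Variable S : seq (set T).
Hypotheses (SD : forall Q, Q \in S -> D Q) (SE : S != [::])
  (Sgood : forall Q, Q \in S -> good Q) (AF : A * F < +oo).

(** A single good cube makes all these quantities finite; this is why the family is taken
    nonempty. *)
Let finite_AFE : [/\ A \is a fin_num, F \is a fin_num, (forall i, E i < +oo),
    (forall i, (0 < fine (E i))%R) & F = (\prod_i fine (E i) `^ (r i / t i))%:E].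
Proof.
case: S SE SD Sgood => // Q S' _ SD' gS'.
by apply: (@good_finite Q) => //; [apply: SD'|apply: gS']; rewrite mem_head.
Qed.

Let muckS Q : Q \in S -> (muckenhoupt_cube r rho t mu v u Q <= fine A)%R.
Proof.
by have [Afin _ _ _ _] := finite_AFE; move=> QS; apply: muckenhoupt_cube_le; auto.
Qed.

Let stepE x : stepmax 0 S cube x = (stepmax 0%R S (cube_value r rho mu f v) x)%:E.
Proof.
have [_ _ Efin _ _] := finite_AFE.
by apply: stepmax_EFin => Q QS; apply: extended_cube_valueE => //; exact: Sgood.
Qed.

(** The level set enters through its indicator, the form in which the limit along the exhaustion is
    taken. *)
Lemma weak_type_good (l : R) : (0 < l)%R ->
  \int[mu]_x ((if l%:E < stepmax 0 S cube x then 1 else 0) * u x) <=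
  (A * F * (l^-1)%:E) `^ alpha^-1.
Proof.
move=> l0; have [Afin _ Efin Egt0 FE'] := finite_AFE.
under eq_integral => x _ do rewrite stepE lte_fin.
rewrite [leLHS](_ : _ = \int[mu]_(x in [set x |
    l < stepmax 0 S (cube_value r rho mu f v) x]%R) u x); last first.
  rewrite [RHS]integral_mkcond; apply: eq_integral => x _.
  rewrite patchE; case: ifPn => [/mem_set|] lx; last first.
    by rewrite memNset ?mul0e//=; exact/negP.
  by rewrite ifT ?mul1e.
apply: le_trans (weak_type_family hr ht hrho0 alpha_gt0 nf
  (fun i => nw (lift ord_max i)) (nw ord_max) Efin (laminarD SD) Sgood muckS l0) _.
have A_ge0 : (0 <= fine A)%R by exact: fine_ge0.
rewrite FE' -[in leRHS](fineK Afin) -!EFinM poweR_EFin lee_fin [leRHS](_ : _ =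
    ((fine A / l) * \prod_i fine (E i) `^ (r i / t i)) `^ alpha^-1)%R; last first.
  by rewrite mulrAC.
rewrite [leRHS]powRM ?divr_ge0 ?(ltW l0)//; last first.
  by apply: prodr_ge0 => i _; exact: powR_ge0.
rewrite powR_prod; last by move=> i; exact: powR_ge0.
by under [in leRHS]eq_bigr do rewrite -powRrM.
Qed.

Lemma strong_type_good : FW < +oo ->
  \int[mu]_x (stepmax 0 S cube x `^ alpha^-1 * u x) <=
  (strong_constant%:E * (A * FW * F)) `^ alpha^-1.
Proof.
move=> FWfin; have [Afin _ Efin Egt0 FE'] := finite_AFE.
have FW0 : 0 <= FW by exact: (ereal_sup_ubound (or_introl erefl)).
have FWE : FW \is a fin_num by rewrite ge0_fin_numE.
have A_ge0 : (0 <= fine A)%R by exact: fine_ge0.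
have FWr_ge0 : (0 <= fine FW)%R by exact: fine_ge0.
under eq_integral => x _ do rewrite stepE poweR_EFin.
(* Inside [P] the densities of the cubes of [S'] are terms of the localized maximal function; off
   [P] the step maximum is 0. *)
have hFW P S' : P \in S -> (forall Q, Q \in S' -> Q \in S /\ Q `<=` P) ->
    \int[mu]_x (stepmax 0%R S' (density r rho t mu v) x)%:E <=
    (fine FW `^ alpha^-1)%:E * \int[mu]_(x in P) geometric_weight x.
  move=> PS S'P; have DP := SD PS; have mP := mD DP.
  have [_ _ _ vP _] := Sgood PS.
  have gfin : \int[mu]_(x in P) geometric_weight x < +oo.
    apply: le_lt_trans (geometric_weight_le_prod DP) _.
    rewrite (eq_bigr (fun i => (mass mu (v i) P `^ (beta i / alpha))%:E)).
      by rewrite prodEFin ltry.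
    by move=> i _; rewrite (massE (vP i)) poweR_EFin.
  rewrite -poweR_EFin fineK//; apply: le_trans (local_maximal_le DP FWfin gfin).
  rewrite [leRHS]integral_mkcond; apply: ge0_le_integral => //.
  - by move=> x _; rewrite lee_fin stepmax_ge_id.
  - by apply: (measurable_stepmax (fun y : R => y%:E)) => Q /S'P[/SD /mD].
  - apply/(measurable_restrictT _ _).1 => //.
    exact/measurable_funTS/measurable_local.
  move=> x _; rewrite -(@stepmax_EFin _ _ _ S' (fun Q => (density r rho t mu v Q)%:E))//.
  rewrite patchE; case: ifPn => [/set_mem Px|]; last first.
    rewrite notin_setE => Px; rewrite stepmax_out// => -[Q /S'P[_ QP] Qx].
    by apply: Px; exact: QP.
  apply: stepmax_le => // Q /S'P[QS QP] Qx; have DQ := SD QS.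
  apply: le_trans (le_local_maximal DQ QP Qx); rewrite -prodEFin.
  have [_ _ _ vQ _] := Sgood QS.
  rewrite le_eqVlt; apply/orP; left; apply/eqP; apply: eq_bigr => i _.
  by rewrite averageE// (massE (vQ i)) -EFinM poweR_EFin mulrC.
apply: le_trans (strong_type_family hr ht hrho0 htrho alpha_gt0 nf
  (fun i => nw (lift ord_max i)) (nw ord_max) Efin (laminarD SD) Sgood muckS
  (powR_ge0 _ _) hFW) _.
rewrite FE' -[in leRHS](fineK Afin) -[in leRHS](fineK FWE) -!EFinM poweR_EFin lee_fin.
have c0 i : (0 <= (2 * (t i / (t i - 1))) `^ t i)%R by exact: powR_ge0.
by rewrite (strong_constant_regroup _ _ _ _ alpha_gt0 A_ge0 FWr_ge0 c0 Egt0).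
Qed.

End good_family.

Local Notation M := (maximal mu D r rho fv).

(** Exhaustion and removal of the bad cubes combined; if no good cube remains, [phi 0 = 0] gives a
    zero integral. *)
Lemma integral_maximal_good_le (phi : \bar R -> \bar R) (B : \bar R) :
  A * F < +oo -> 0 <= B -> phi 0 = 0 -> (forall y, 0 <= phi y) ->
  (forall y z, 0 <= y -> y <= z -> phi y <= phi z) ->
  (forall (s : nat -> \bar R) z, (forall N, 0 <= s N) ->
     (forall N, phi (s N) <= z) -> phi (ereal_sup (range s)) <= z) ->
  (forall S : seq (set T), (forall Q, Q \in S -> D Q) -> S != [::] ->
    (forall Q, Q \in S -> good Q) ->
    \int[mu]_x (phi (stepmax 0 S cube x) * u x) <= B) ->
  \int[mu]_x (phi (M x) * u x) <= B.
Proof.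
move=> AF B0 phi00 phi0 phi_le phi_sup SB.
case: (gridD) => /countable_exhaustion[e [eD e_homo De]] _ _.
apply: (integral_maximal_le eD e_homo De mD (nw ord_max)) => // S SD.
apply: le_trans (integral_stepmax_discard (good := fun Q => `[< good Q >])
  mD (nw ord_max) phi0 phi_le SD _) _.
  by move=> Q QS /asboolPn; exact/good_or_null/AF/SD.
have [->|S_neq0] := eqVneq [seq Q <- S | `[< good Q >]] [::].
  rewrite (eq_integral (cst 0)) ?integral0// => x _.
  by rewrite /stepmax big_nil phi00 mul0e.
apply: SB => // Q; rewrite mem_filter => /andP[]; first by move=> _ /SD.
by move=> /asboolP.
Qed.

Lemma weak_type_maximal (l : R) : A * F < +oo -> (0 < l)%R ->
  \int[mu]_(x in [set x | l%:E < M x]) u x <= (A * F * (l^-1)%:E) `^ alpha^-1.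
Proof.
move=> AF l0.
rewrite [leLHS](_ : _ = \int[mu]_x ((if l%:E < M x then 1 else 0) * u x)).
  apply: (@integral_maximal_good_le (fun y => if l%:E < y then 1 else 0)) => //.
  - exact: poweR_ge0.
  - by rewrite ltNge lee_fin ltW.
  - by move=> y; case: ifP.
  - move=> y z y0 yz; case: ifPn => [ly|_]; last by case: ifP.
    by rewrite (lt_le_trans ly).
  (* A supremum strictly above [l] already has a term above [l]. *)
  - move=> s z s0 sz; case: ifPn => [|_]; last first.
      by apply: le_trans (sz 0%N); case: ifP.
    by move=> /ereal_sup_gt[_ [N _ <-] lN]; have := sz N; rewrite lN.
  - by move=> S SD SE gS; exact: weak_type_good.
rewrite integral_mkcond; apply: eq_integral => x _.
rewrite patchE; case: ifPn => [/set_mem/= ->|]; first by rewrite mul1e.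
by rewrite notin_setE/= => /negP/negbTE ->; rewrite mul0e.
Qed.

(** A good cube forces [A * F > 0], which gives the finiteness of [FW] where it is used; for
    [A * F = 0] there are no good cubes and both sides vanish. *)
Lemma strong_type_maximal : A * F < +oo -> (0 < A * F -> FW < +oo) ->
  \int[mu]_x (M x `^ alpha^-1 * u x) <=
  (strong_constant%:E * (A * FW * F)) `^ alpha^-1.
Proof.
move=> AF FWfin; have p0 : (0 < alpha^-1)%R by rewrite invr_gt0.
have p_neq0 : (alpha^-1 != 0)%R by rewrite gt_eqF.
apply: (@integral_maximal_good_le (fun y => y `^ alpha^-1)) => //.
- exact: poweR_ge0.
- by rewrite poweR0r.
- by move=> y; exact: poweR_ge0.
- by move=> y z y0 yz; apply: le_poweR => //; exact: ltW.
- move=> s z s0 sz; have z0 : 0 <= z by apply: le_trans (sz 0%N); exact: poweR_ge0.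
  have a_neq0 : (alpha != 0)%R by rewrite gt_eqF.
  rewrite -[leRHS](poweRK a_neq0)//; apply: le_poweR; first exact: ltW.
    by apply: le_trans (s0 0%N) _; apply: ereal_sup_ubound; exists 0%N.
  apply: ge_ereal_sup => _ [N _ <-].
  rewrite -[leLHS](poweRVK a_neq0)//; apply: le_poweR => //; first exact: ltW.
  exact: poweR_ge0.
move=> S SD SE gS; apply: strong_type_good => //; apply: FWfin.
case: S SE SD gS => // Q S _ SD gS; have QS := mem_head Q S.
by have [A_gt0 F_gt0 _] := good_gt0 (SD _ QS) (gS _ QS); exact: mule_gt0.
Qed.

Lemma maximal_empty : ~ (exists Q, D Q) -> M = cst 0.
Proof.
move=> noQ; apply/funext => x; apply/le_anti/andP; split; last exact: maximal_ge0.
by apply: ge_ereal_sup => y [->//|[Q [DQ _] _]]; case: noQ; exists Q.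
Qed.

End main_estimates.

(** * Choice of the constant and degenerate cases *)

Theorem theorem1p7 (R : realType) (n : nat) (hm : (2 <= n.+1)%N)
    (r rho t : 'I_n -> R)
    (hr : forall i, (0 < r i)%R)
    (hrho : forall i, (0 <= rho i < 1)%R)
    (ht : forall i, (1 < t i)%R /\ (t i)%:E < ((rho i)%:E)^-1) :
  let beta : 'I_n -> R := fun i => (r i * ((t i)^-1 - rho i))%R in
  let alpha : R := (\sum_(i < n) beta i)%R in
  let q : 'I_n.+1 -> R :=
    append_last (fun i => r i / conj_exponent (t i))%R alpha in
  exists C : R, (0 < C)%R /\
  forall (d : measure_display) (X : measurableType d)
    (mu : {measure set X -> \bar R}) (D : set (set X)),
  non_atomic mu -> dyadic_grid mu D ->
  forall (w : 'I_n.+1 -> X -> \bar R) (f : 'I_n -> X -> \bar R),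
  (forall i, nonneg_measurable (w i)) ->
  (forall i, nonneg_measurable (f i)) ->
  let v : 'I_n -> X -> \bar R := fun i => w (lift ord_max i) in
  let M : X -> \bar R := maximal mu D r rho (fun i x => f i x * v i x) in
  let F : \bar R := \prod_(i < n) weighted_norm mu (t i) (v i) (f i) `^ r i in
  weak_weighted_norm mu alpha^-1 (w ord_max) M
    <= C%:E * (muckenhoupt mu D q w * F) /\
  weighted_norm mu alpha^-1 (w ord_max) M
    <= C%:E * (muckenhoupt mu D q w
               * fujii_wilson mu D (append_last beta 0%R) w * F).
Proof.
move=> beta alpha q.
have hrho0 i : (0 <= rho i)%R by case/andP: (hrho i).
have ht1 i : (1 < t i)%R by case: (ht i).
have t0 i : (0 < t i)%R by apply: lt_trans (ht1 i).
(* The upper bound on [t i] is inverted; for [rho i = 0] it reads [t i < +oo]. *)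
have htrho i : (rho i < (t i)^-1)%R.
  have [_] := ht i; rewrite inver; case: eqP => [-> _|/eqP rho_neq0].
    by rewrite invr_gt0.
  have rho_gt0 : (0 < rho i)%R by rewrite lt0r rho_neq0 hrho0.
  by rewrite lte_fin -[ltRHS]div1r ltr_pdivlMr// mulrC -ltr_pdivlMr// div1r.
have alpha_gt0 : (0 < alpha)%R.
  have beta_gt0 i : (0 < beta i)%R by rewrite mulr_gt0// subr_gt0.
  rewrite /alpha (bigD1 (Ordinal (hm : (0 < n)%N)))//=.
  by rewrite ltr_wpDr// sumr_ge0// => i _; exact: ltW.
have C1_ge0 := strong_constant_ge0 r rho t.
(* The weak-type estimate holds with constant 1, so this sum serves both. *)
exists (1 + strong_constant r rho t)%R; split; first by rewrite ltr_pwDl.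
move=> d X mu D _ gridD w f nw nf v M F.
set A := muckenhoupt mu D q w; set FW := fujii_wilson mu D _ w.
have A0 : 0 <= A by exact: (ereal_sup_ubound (or_introl erefl)).
have F0 : 0 <= F by apply: prode_ge0 => i _; exact: poweR_ge0.
have FW0 : 0 <= FW by exact: (ereal_sup_ubound (or_introl erefl)).
have C1 : (0 < 1 + strong_constant r rho t)%R by rewrite ltr_pwDl.
have a_neq0 : (alpha != 0)%R by rewrite gt_eqF.
have p0 : (0 < alpha^-1)%R by rewrite invr_gt0.
split.
  have [AFy|AFy] := eqVneq (A * F) +oo; first by rewrite AFy gt0_muley ?leey.
  have AF : A * F < +oo by rewrite ltey.
  apply: (@le_trans _ _ (A * F)); last first.
    by rewrite -[leLHS]mul1e lee_wpmul2r ?mule_ge0// lee_fin lerDl.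
  apply: ge_ereal_sup => _ [->|[l /= l0 <-]]; first exact: mule_ge0.
  (* At each level the estimate is raised to the power [alpha] and multiplied by [l], which cancels
     [1 / l]. *)
  have := weak_type_maximal hr ht1 hrho0 alpha_gt0 gridD nw nf AF l0.
  move=> /(le_poweR (ltW alpha_gt0)); rewrite integral_ge0; last first.
    by move=> x _; exact: (nw _).2.
  move=> /(_ isT); rewrite poweRVK// ?mule_ge0 ?lee_fin ?invr_ge0 ?(ltW l0)// => key.
  rewrite invrK; apply: le_trans (lee_wpmul2l _ key) _; first by rewrite lee_fin ltW.
  by rewrite muleC -muleA -EFinM mulVf ?gt_eqF// mule1.
(* Without cubes the Fujii-Wilson characteristic is 0, but so is the maximal operator. *)
have [[P DP]|noP] := pselect (exists Q, D Q); last first.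
  rewrite /M maximal_empty//.
  rewrite /weighted_norm (eq_integral (cst 0)) ?integral0.
    by rewrite poweR0r ?invr_eq0 ?gt_eqF// !mule_ge0// lee_fin ltW.
  by move=> x _; rewrite poweR0r ?mul0e// gt_eqF.
have FW1 : 1 <= FW := fujii_wilson_ge1 hr htrho alpha_gt0 gridD nw DP.
have FW_gt0 : 0 < FW by apply: lt_le_trans FW1.
have AFW : A * FW * F = A * F * FW by rewrite muleAC.
have AF_ge0 : 0 <= A * F by exact: mule_ge0.
rewrite AFW; have [AFy|AFy] := eqVneq (A * F) +oo.
  by rewrite AFy gt0_mulye// gt0_muley ?leey.
have AF : A * F < +oo by rewrite ltey.
(* An infinite characteristic makes the right-hand side infinite if [A * F > 0]; what remains is the
   case of [strong_type_maximal]. *)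
have [/andP[AF_gt0 /eqP FWy]|FWfin] := boolP ((0 < A * F) && (FW == +oo)).
  by rewrite FWy !gt0_muley ?leey.
have {}FWfin : 0 < A * F -> FW < +oo.
  by move=> AF_gt0; move: FWfin; rewrite AF_gt0/= ltey.
have := strong_type_maximal hr ht1 hrho0 htrho alpha_gt0 gridD nw nf AF FWfin.
move=> /(le_poweR (ltW alpha_gt0)); rewrite integral_ge0; last first.
  by move=> x _; rewrite mule_ge0 ?poweR_ge0//; exact: (nw _).2.
move=> /(_ isT); rewrite poweRVK//; last by rewrite !mule_ge0// lee_fin.
rewrite /weighted_norm invrK => /le_trans; apply.
by rewrite AFW; apply: lee_wpmul2r; rewrite ?mule_ge0// lee_fin lerDr.
Qed.
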